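(* For all $H\in(1/4,1/2)\cup(1/2,1)$ and all $t\ge 0$, almost surely $Z^H(t)\in E$. Moreover, for all $p\in\mathbb{N}$ one has \[ \sup_{t\ge 0}\mathbb{E}[\|Z^H(t)\|_E^{2p}]<\infty. \]
   Context: $\mathbb{N}=\{1,2,\ldots\}$. $E=\mathcal{C}([0,1];\mathbb{R})$ with norm $\|x\|_E=\max_{\xi\in[0,1]}|x(\xi)|$. $\mathbb{H}=L^2((0,1);\mathbb{R})$. For $k\in\mathbb{N}$, $\lambda_k=k^2\pi^2$, $e_k=\sqrt2\sin(k\pi\cdot)$ (eigenpairs of $Ax=-x''$ on $(0,1)$ with homogeneous Dirichlet boundary conditions). $S(t)x=\sum_ke^{-\lambda_kt}\langle x,e_k\rangle e_k$. $(\beta_k^H)_{k\in\mathbb{N}}$ are independent real-valued fractional Brownian motions with Hurst index $H$ (centered Gaussian, continuous paths, covariance $\frac12(t^{2H}+s^{2H}-|t-s|^{2H})$), and $B^H(t)=\sum_k\beta_k^H(t)e_k$ (formal series). For $\phi\in\mathcal{C}^1([0,t])$, $\int_0^t\phi(s)\,d\beta_k^H(s)=\phi(t)\beta_k^H(t)-\int_0^t\phi'(s)\beta_k^H(s)\,ds$. The fractional Ornstein–Uhlenbeck process is \[ Z^H(t)=\int_0^tS(t-s)\,dB^H(s)=\sum_{k\in\mathbb{N}}\mathcal{Z}_k^H(t)e_k,\qquad \mathcal{Z}_k^H(t)=\int_0^te^{-\lambda_k(t-s)}\,d\beta_k^H(s). \] The statement $Z^H(t)\in E$ means that the $\mathbb{H}$-valued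 random variable $Z^H(t)$ has a representative which is a continuous function on $[0,1]$. *)

(* Defs.v *)
From HB Require Import structures.
From mathcomp Require Import all_boot all_order all_algebra finmap.
From mathcomp Require Import all_classical all_reals all_analysis.
Set Implicit Arguments.
Unset Strict Implicit.
Unset Printing Implicit Defensive.
Import Order.TTheory GRing.Theory Num.Theory.
Import numFieldNormedType.Exports.
Local Open Scope classical_set_scope.
Local Open Scope ring_scope.

Section Probability.
Context {d : measure_display} {T : measurableType d} {R : realType}.
Variable P : probability T R.

(* [normal_prob m s] is only the normal law for [s != 0]; degenerate Gaussian
   laws are Dirac masses. *)
Definition gaussian_rv (X : T -> R) : Prop :=
  measurable_fun [set: T] X /\
  exists m s : R, 0 <= s /\
    forall B : set R, measurable B ->
      P (X @^-1` B) = if s == 0 then \d_m B else normal_prob m s B.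

(* Processes are indexed by all of [R]; only times [0 <= t] are ever used, and
   nothing is assumed about negative times. *)
Definition gaussian_process (b : R -> {RV P >-> R}) : Prop :=
  forall (n : nat) (t a : 'I_n -> R), (forall i, 0 <= t i) ->
    gaussian_rv (fun w => \sum_(i < n) a i * b (t i) w).

Definition fractional_brownian_motion (H : R) (b : R -> {RV P >-> R}) : Prop :=
  [/\ gaussian_process b,
      forall t : R, 0 <= t -> ('E_P[b t] = 0)%E,
      forall s t : R, 0 <= s -> 0 <= t ->
        covariance P (b t) (b s) =
          (2^-1 * (t `^ (2 * H) + s `^ (2 * H) - `|t - s| `^ (2 * H)))%:E
    & forall w, {within `[0, +oo[, continuous (fun t : R => b t w)}].

Definition process_sigma (b : R -> {RV P >-> R}) : set (set T) :=
  <<s [set A | exists (t : R) (B : set R),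
         [/\ 0 <= t, measurable B & A = b t @^-1` B] ] >>.

Definition independent_processes (I : set nat)
    (b : nat -> R -> {RV P >-> R}) : Prop :=
  forall (J : {fset nat}) (A : nat -> set T),
    (forall k : nat, k \in J -> I k) ->
    (forall k : nat, k \in J -> process_sigma (b k) (A k)) ->
    P (\bigcap_(k in [set` J]) A k) = (\prod_(k <- J) P (A k))%E.

End Probability.

Section Spaces.
Context {R : realType}.

Definition lebesgue01 : {measure set (measurableTypeR R) -> \bar R} :=
  mrestr lebesgue_measure (measurable_itv `]0, 1[ : measurable (`]0, 1[ : set R)).

Definition eigval (k : nat) : R := k%:R ^+ 2 * pi ^+ 2.

Definition eigfun (k : nat) (xi : R) : R := Num.sqrt 2 * sin (k%:R * pi * xi).

(* The sum in L^2(0,1) of the series of general term [c k *: eigfun k], k >= 1,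
   as an almost-everywhere class: the set of all its representatives.  It is
   empty when the series diverges. *)
Definition L2_series (c : nat -> R) : set (R -> R) :=
  [set x | x \in Lfun lebesgue01 2%:E /\
     ('N[lebesgue01]_2%:E[EFin \o (fun xi : R =>
        x xi - \sum_(1 <= k < n.+1) c k * eigfun k xi)%R])%E
       @[n --> \oo] --> 0%E].

Definition E_space : set (R -> R) := [set x : R -> R | {within `[0, 1], continuous x}].

Definition E_norm (x : R -> R) : R := sup [set `|x xi| | xi in `[0, 1]%classic].

Definition class_in_E (X : set (R -> R)) : Prop := X `&` E_space !=set0.

(* Two continuous representatives agree on [0, 1], so the choice made by [xget]
   is immaterial; the default value 0 is only used when there is none. *)
Definition class_E_norm (X : set (R -> R)) : R :=
  E_norm (xget (cst 0) (X `&` E_space)).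

(* The pathwise integral of [phi] against [db] over [0, t], by parts. *)
Definition path_integral (phi b : R -> R) (t : R) : R :=
  phi t * b t - \int[lebesgue_measure]_(s in `[0, t]) (phi^`()%classic s * b s).

End Spaces.

Section OrnsteinUhlenbeck.
Context {d : measure_display} {T : measurableType d} {R : realType}.
Context {P : probability T R}.
Variable b : nat -> R -> {RV P >-> R}.

Definition fou_coef (t : R) (w : T) (k : nat) : R :=
  path_integral (fun s => expR (- eigval k * (t - s))) (fun s => b k s w) t.

Definition fou (t : R) (w : T) : set (R -> R) := L2_series (fou_coef t w).

End OrnsteinUhlenbeck.

(* Main.v *)
Require Import Defs.
From mathcomp Require Import all_boot all_order all_algebra finmap.
From mathcomp Require Import all_classical all_reals all_analysis.
From mathcomp Require Import measurable_realfun ring lra zify.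
Set Implicit Arguments.
Unset Strict Implicit.
Unset Printing Implicit Defensive.
Import Order.TTheory GRing.Theory Num.Theory.
Import numFieldNormedType.Exports.
Local Open Scope classical_set_scope.
Local Open Scope ring_scope.

(** Fix a time [t] and write [Z_k] for the [k]-th coefficient of the process.  All
probabilistic estimates are phrased as sub-Gaussian bounds, that is bounds of
the Laplace transform by that of a centered normal law.

The size of one coefficient.  Let [l = eigval k] and let [b] be the [k]-th
fractional Brownian motion.  Since the kernel [s |-> exp (- l * (t - s))] is
nonnegative and increases from [exp (- l * t)] to 1, integration by parts
exhibits [Z_k], up to a limit of Riemann-Stieltjes sums, as a combination with
nonnegative weights of [b t] and of the increments [b t - b s].  These have
standard deviation [t `^ H] and [(t - s) `^ H], both at most
[l `^ (- H) * (1 + l * (t - s))] (with [s = 0] for the former), and the weighted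
sum of these bounds is at most [3 * l `^ (- H)] uniformly in [t].  The triangle
inequality for sub-Gaussian norms and Fatou's lemma give
[path_integral_subgaussian]: [Z_k] is sub-Gaussian with standard deviation
[3 * eigval k `^ (- H)], of order [k `^ (- 2 * H)].

Blocks of the series.  By independence ([subgaussian_indep_sum]) the variance
proxies add up, so that a piece of the dyadic block [2^j <= k < 2^(j+1)] of the
sine series, evaluated at a point, has variance proxy of order
[2^j * 2^(- 4 * H * j)].  As [4 * H > 1] this is at most [25 * q^(4 * j)] for some
[q < 1].  The moment of order [2 * m] of such a value is thus of order
[q^(4 * m * j)], which for [m] large beats the exponential count [32^j] of values.
The random variable [energy] adds up, with the weights [q^(- 2 * m * j)], the
powers [2 * m] of all partial sums of all blocks at the points of the grid of
step [16^(-j)], together with weighted powers of the coefficients themselves; its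
expectation is bounded independently of [t] ([integral_energy_le]).

From the energy to the sup norm.  Where the energy is [y ^ (2 * m)], every
partial block sum is at most [y * q^j] on its grid; the grid is so fine that the
bound extends, up to a constant, to the whole of [0, 1] ([block_le]).  Summing
the geometric series, the partial sums of the sine series converge uniformly to a
continuous function bounded by a multiple of [y], which represents the
[L^2]-class of the series ([class_in_E_L2_series], [class_E_norm_L2_series]).
Hence the representative exists wherever the energy is finite, and the power
[2 * m] of its sup norm is bounded by a multiple of the energy. *)

(** * Integrals against weighted image measures *)

Section WeightedImage.
Local Open Scope ereal_scope.
Import HBNNSimple.

(** Approximating [f] from below by simple functions shows that the integral only
depends on the masses [\int[mu]_(x in phi @^-1` B) (g x)%:E]. *)
Lemma integral_weighted_image_lim (R : realType) (d1 d2 : measure_display)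
    (X : measurableType d1) (Y : measurableType d2)
    (mu : {measure set X -> \bar R}) (phi : X -> Y) (g : X -> R)
    (f : Y -> \bar R) (mf : measurable_fun [set: Y] f) :
  measurable_fun [set: X] phi -> measurable_fun [set: X] g ->
  (forall x, 0 <= g x)%R -> (forall y, 0 <= f y) ->
  \int[mu]_x (f (phi x) * (g x)%:E) =
  limn (fun n => \sum_(k \in range (nnsfun_approx measurableT mf n))
    k%:E * \int[mu]_(x in phi @^-1` (nnsfun_approx measurableT mf n @^-1` [set k]))
             (g x)%:E).
Proof.
move=> mphi mg g0 f0; set h := nnsfun_approx measurableT mf.
have mhphi n k : measurable (phi @^-1` (h n @^-1` [set k])).
  by rewrite -[X in measurable X]setTI; exact: mphi.
transitivity (limn (fun n => \int[mu]_x ((h n (phi x))%:E * (g x)%:E))).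
  rewrite -monotone_convergence//.
  - apply: eq_integral => x _; apply/esym/cvg_lim => //.
    by apply: cvgeZr => //; apply: cvg_nnsfun_approx => // *; exact: f0.
  - move=> n; apply/measurable_EFinP; apply: measurable_funM => //.
    exact: measurableT_comp.
  - by move=> n x _; rewrite mule_ge0// lee_fin.
  - move=> x _ a b ab; rewrite lee_wpmul2r// lee_fin//.
    exact/lefP/nd_nnsfun_approx.
congr (limn _); apply/funext => n.
transitivity (\int[mu]_x (\sum_(k \in range (h n))
    (k * \1_(phi @^-1` (h n @^-1` [set k])) x)%:E * (g x)%:E)).
  apply: eq_integral => x _.
  rewrite -ge0_mule_fsuml; last first.
    by move=> y; have := nnfun_muleindic_ge0 (h n) y (phi x).
  by rewrite fsumEFin// {1}fimfunE.
have mgE : measurable_fun [set: X] (EFin \o g) by exact/measurable_EFinP.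
rewrite ge0_integral_fsum//; last 2 first.
- move=> k; apply: emeasurable_funM => //; apply/measurable_EFinP.
  by apply: measurable_funM.
- move=> k x _; rewrite mule_ge0// ?lee_fin//.
  by have := nnfun_muleindic_ge0 (h n) k (phi x).
apply: eq_fsbigr => k /[!inE] -[y _ hk].
have k0 : (0 <= k)%R by rewrite -hk.
under eq_integral do rewrite EFinM -muleA.
rewrite ge0_integralZl//; last 2 first.
- by apply: emeasurable_funM => //; apply/measurable_EFinP.
- by move=> x _; rewrite mule_ge0// lee_fin.
congr (_ * _); rewrite [RHS]integral_mkcond; apply: eq_integral => x _.
by rewrite epatch_indic muleC.
Qed.

(** This serves twice: with a Lebesgue density on one side, it turns the law of a
Gaussian variable into an integral against its density; with the same variable on
both sides, it lets a function of that variable replace an indicator in an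
independence relation. *)
Lemma eq_integral_weighted_image (R : realType) (d1 d2 d3 : measure_display)
    (X1 : measurableType d1) (X2 : measurableType d2) (Y : measurableType d3)
    (mu1 : {measure set X1 -> \bar R}) (mu2 : {measure set X2 -> \bar R})
    (phi1 : X1 -> Y) (phi2 : X2 -> Y) (g1 : X1 -> R) (g2 : X2 -> R)
    (f : Y -> \bar R) :
  measurable_fun [set: X1] phi1 -> measurable_fun [set: X2] phi2 ->
  measurable_fun [set: X1] g1 -> measurable_fun [set: X2] g2 ->
  (forall x, 0 <= g1 x)%R -> (forall x, 0 <= g2 x)%R ->
  measurable_fun [set: Y] f -> (forall y, 0 <= f y) ->
  (forall B, measurable B ->
    \int[mu1]_(x in phi1 @^-1` B) (g1 x)%:E =
    \int[mu2]_(x in phi2 @^-1` B) (g2 x)%:E) ->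
  \int[mu1]_x (f (phi1 x) * (g1 x)%:E) = \int[mu2]_x (f (phi2 x) * (g2 x)%:E).
Proof.
move=> mphi1 mphi2 mg1 mg2 g10 g20 mf f0 H.
rewrite !(@integral_weighted_image_lim _ _ _ _ _ _ _ _ _ mf)//.
congr (limn _); apply/funext => n; apply: eq_fsbigr => k _.
by rewrite H.
Qed.

End WeightedImage.

(** * Laplace transforms of Gaussian variables *)

Section Gaussian.
Local Open Scope ereal_scope.
Context (R : realType) (d : measure_display) (T : measurableType d)
        (P : probability T R).

(** Completing the square: an exponential tilt of a normal density is a multiple of
the normal density with shifted mean. *)
Lemma normal_pdf_tilt (a m s x : R) : s != 0%R ->
  (expR (a * x) * normal_pdf m s x =
   expR (a * m + a ^+ 2 * s ^+ 2 / 2) * normal_pdf (m + a * s ^+ 2) s x)%R.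
Proof.
move=> s0; rewrite !normal_pdfE// !(mulrCA _ (normal_peak s)); congr (_ * _)%R.
rewrite /normal_fun -!expRD; congr expR.
by rewrite -mulr_natr; field.
Qed.

(** One formula covers the degenerate law, for which [s = 0]. *)
Lemma gaussian_rv_mgf (X : T -> R) : gaussian_rv P X ->
  exists m s : R, forall a : R,
    \int[P]_w (expR (a * X w))%:E = (expR (a * m + a ^+ 2 * s ^+ 2 / 2))%:E.
Proof.
move=> [mX [m [s [s0 Xms]]]]; exists m, s => a.
pose f (x : R) : \bar R := (expR (a * x))%:E.
have mf : measurable_fun [set: R] f.
  by apply/measurable_EFinP; apply: measurableT_comp => //; exact: measurable_funM.
have mXB B : measurable B -> measurable (X @^-1` B).
  by move=> mB; rewrite -[X in measurable X]setTI; exact: mX.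
have [s_0|sn0] := eqVneq s 0%R.
  transitivity (\int[P]_w (f (X w) * (cst 1%R w)%:E)).
    by apply: eq_integral => w _; rewrite /f /= mule1.
  rewrite (@eq_integral_weighted_image R _ _ _ T _ _ P (dirac m) X id
    (cst 1%R) (cst 1%R) f)//.
  - under eq_integral do rewrite mule1.
    rewrite integral_dirac// diracT mul1e /f s_0.
    by rewrite expr0n/= mulr0 mul0r addr0.
  - by move=> w; rewrite lee_fin.
  - move=> B mB; rewrite /= !integral_cst//; last exact: mXB.
    by congr (1 * _); have := Xms B mB; rewrite s_0 eqxx.
transitivity (\int[P]_w (f (X w) * (cst 1%R w)%:E)).
  by apply: eq_integral => w _; rewrite /f /= mule1.
rewrite (@eq_integral_weighted_image R _ _ _ T _ _ P lebesgue_measure X id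
  (cst 1%R) (normal_pdf m s) f)//.
- under eq_integral do rewrite /f -EFinM normal_pdf_tilt// EFinM.
  rewrite ge0_integralZl ?lee_fin ?expR_ge0//.
  + by rewrite integral_normal_pdf mule1.
  + by apply/measurable_EFinP; exact: measurable_normal_pdf.
  + by move=> x _; rewrite lee_fin normal_pdf_ge0.
- exact: measurable_normal_pdf.
- by move=> x; exact: normal_pdf_ge0.
- by move=> w; rewrite lee_fin.
- move=> B mB; rewrite /= integral_cst//; last exact: mXB.
  by rewrite mul1e; have := Xms B mB; rewrite (negbTE sn0).
Qed.

End Gaussian.

(** * Sub-Gaussian variables *)

Section ExpBounds.
Context (R : realType).
Implicit Types a x : R.

(** The source of second moments: finiteness of the Laplace transform at 1 and -1. *)
Lemma sqr_le_expR x : x ^+ 2 <= 2 * (expR x + expR (- x)).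
Proof.
wlog x0 : x / 0 <= x.
  move=> H; have [/H//|/ltW x0] := leP 0 x.
  by have := H (- x); rewrite oppr_ge0 sqrrN opprK addrC; exact.
have := @expR_ge1Dxn _ x 1 x0; rewrite (_ : 2`!%:R = 2 :> R)//.
have := expR_gt0 (- x); lra.
Qed.

(** The hyperbolic cosine agrees with its Taylor polynomial of order 2 up to
[O(a ^ 3)], with a remainder that keeps a finite expectation; dividing by [a ^ 2]
and letting [a] tend to 0 then isolates the second moment. *)
Lemma expR_symD_le a x : 0 <= a <= 1 ->
  expR (a * x) + expR (- (a * x)) <=
  2 + a ^+ 2 * x ^+ 2 + 6 * a ^+ 3 * (expR (2 * x) + expR (- (2 * x))).
Proof.
move=> /andP[a0 a1]; wlog x0 : x / 0 <= x.
  move=> H; have [/H//|/ltW x0] := leP 0 x.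
  have := H (- x); rewrite oppr_ge0 => /(_ x0).
  rewrite !mulrN !opprK sqrrN (addrC (expR (- (a * x)))).
  by rewrite (addrC (expR (- (2 * x)))).
set y := a * x.
have y0 : 0 <= y by rewrite mulr_ge0.
have yx : y <= x by rewrite ler_piMl.
have Ey : expR y * expR (- y) = 1 by rewrite -expRD subrr expR0.
have E1 : 1 - y <= expR (- y) by exact: expR_ge1Dx.
have E2 : expR (- y) <= 1 by rewrite -[leRHS]expR0 ler_expR oppr_le0.
have E3 : expR y <= 1 + y * expR y.
  have : expR y * (1 - y) <= 1 by rewrite -[leRHS]Ey ler_wpM2l ?expR_ge0.
  by lra.
have E4 : expR y + expR (- y) - 2 <= y ^+ 2 * expR y.
  have -> : expR y + expR (- y) - 2 = (1 - expR (- y)) ^+ 2 * expR y.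
    rewrite -[X in _ - X]mulr1 -[X in _ - 2 * X]Ey.
    have : expR y * expR (- y) * expR (- y) = expR (- y) by rewrite Ey mul1r.
    by move=> h; rewrite -[X in _ + X - _]h; ring.
  rewrite ler_wpM2r ?expR_ge0// ler_sqr ?nnegrE//; lra.
have E5 : y ^+ 3 * expR y <= 6 * a ^+ 3 * expR (2 * x).
  have x3 : x ^+ 3 <= 6 * expR x.
    have := @expR_ge1Dxn _ x 2 x0; rewrite (_ : 3`!%:R = 6 :> R)//; lra.
  rewrite /y exprMn mulrAC mulrC (_ : 2 * x = x + x) ?expRD; last by ring.
  rewrite [leRHS](_ : _ = (6 * expR x) * (a ^+ 3 * expR x)); last by ring.
  apply: ler_pM => //; first by rewrite exprn_ge0.
    by rewrite mulr_ge0 ?exprn_ge0 ?expR_ge0.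
  by rewrite ler_wpM2l ?exprn_ge0// ler_expR.
have E6 : y ^+ 2 * expR y <= y ^+ 2 + y ^+ 3 * expR y.
  have := ler_wpM2l (sqr_ge0 y) E3.
  by rewrite mulrDr mulr1 mulrA -exprSr.
have E7 : 0 <= 6 * a ^+ 3 * expR (- (2 * x)).
  by rewrite !mulr_ge0 ?exprn_ge0 ?expR_ge0.
have -> : a ^+ 2 * x ^+ 2 = y ^+ 2 by rewrite exprMn.
lra.
Qed.

End ExpBounds.

Section SubGaussian.
Local Open Scope ereal_scope.
Context {R : realType} {d : measure_display} {T : measurableType d}.

Lemma Lnorm2_sqrt (mu : {measure set T -> \bar R}) (f : T -> R) :
  'N[mu]_2%:E[EFin \o f] = (\int[mu]_x (f x ^+ 2)%:E) `^ 2^-1.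
Proof.
rewrite unlock; congr (_ `^ _); apply: eq_integral => x _ /=.
by rewrite (powR_mulrn 2)// real_normK// num_real.
Qed.

Lemma Lfun2_sqr_lty (mu : {measure set T -> \bar R}) (f : T -> R) :
  measurable_fun setT f -> \int[mu]_x (f x ^+ 2)%:E < +oo ->
  f \in Lfun mu 2%:E.
Proof.
move=> mf f2; rewrite inE; apply/andP; split; rewrite inE//=.
by rewrite /finite_norm Lnorm2_sqrt poweR_lty.
Qed.

Variable P : probability T R.

Definition subgaussian (X : T -> R) (v : R) : Prop :=
  measurable_fun [set: T] X /\
  forall a : R, \int[P]_w (expR (a * X w))%:E <= (expR (a ^+ 2 * v / 2))%:E.

Lemma measurable_expRM (X : T -> R) (a : R) : measurable_fun [set: T] X ->
  measurable_fun [set: T] (fun w => (expR (a * X w))%:E).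
Proof.
move=> mX; apply/measurable_EFinP; apply: measurableT_comp => //.
exact: measurable_funM.
Qed.

Lemma mgf_Lfun2 (X : T -> R) : measurable_fun [set: T] X ->
  \int[P]_w (expR (1 * X w))%:E < +oo ->
  \int[P]_w (expR (-1 * X w))%:E < +oo -> X \in Lfun P 2%:E.
Proof.
move=> mX h1 h2; apply: Lfun2_sqr_lty => //.
apply: (@le_lt_trans _ _ (\int[P]_w
    (2%:E * ((expR (1 * X w))%:E + (expR (-1 * X w))%:E)))).
  apply: ge0_le_integral => //.
  - by move=> w _; rewrite lee_fin sqr_ge0.
  - by apply/measurable_EFinP; exact: measurable_funX.
  - by apply: emeasurable_funM => //; apply: emeasurable_funD; exact: measurable_expRM.
  - by move=> w _; rewrite -EFinD -EFinM lee_fin mul1r mulN1r sqr_le_expR.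
rewrite ge0_integralZl//; last 2 first.
- by apply: emeasurable_funD; exact: measurable_expRM.
- by move=> w _; rewrite -EFinD lee_fin addr_ge0 ?expR_ge0.
rewrite ge0_integralD//; [|exact: measurable_expRM|exact: measurable_expRM].
by rewrite lte_mul_pinfty// lte_add_pinfty.
Qed.

Lemma gaussian_rv_Lfun2 (X : T -> R) : gaussian_rv P X -> X \in Lfun P 2%:E.
Proof.
move=> gX; have [m [s h]] := gaussian_rv_mgf gX.
apply: mgf_Lfun2; first by case: gX.
- by rewrite h ltry.
- by rewrite h ltry.
Qed.

Lemma Lfun2_Lfun1 (X : T -> R) : X \in Lfun P 2%:E -> X \in Lfun P 1.
Proof. by apply: Lfun_subset12; exact: fin_num_measure. Qed.

(** The parameters of the law are recovered from the first two moments through the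
Laplace transform: [1 + a * X <= exp (a * X)] for all [a] forces the mean
parameter to vanish, and [expR_symD_le] as [a] tends to 0 bounds the variance
parameter by the variance. *)
Lemma centered_gaussian_subgaussian (X : T -> R) (v : R) :
  gaussian_rv P X -> 'E_P[X] = 0 -> 'V_P[X] = v%:E -> subgaussian X v.
Proof.
move=> gX EX0 VX; have mX : measurable_fun [set: T] X by case: gX.
have X2 := gaussian_rv_Lfun2 gX.
have X1 := Lfun2_Lfun1 X2.
have [m [s h]] := gaussian_rv_mgf gX.
have quad a : (0 <= a * m + a ^+ 2 * s ^+ 2 / 2)%R.
  suff : 1 <= (expR (a * m + a ^+ 2 * s ^+ 2 / 2))%:E.
    by rewrite lee_fin -{1}(expR0 R) ler_expR.
  rewrite -h.
  have iX : P.-integrable [set: T] (EFin \o X) by exact/Lfun1_integrable.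
  have iaX : P.-integrable [set: T] (fun w => a%:E * (X w)%:E) by exact: integrableZl.
  have i1 : P.-integrable [set: T] (EFin \o cst 1%R).
    exact: finite_measure_integrable_cst.
  have <- : \int[P]_w ((cst 1%R w)%:E + (a%:E * (X w)%:E)) = 1.
    rewrite integralD//= integral_cst//= probability_setT mul1e.
    rewrite integralZl//.
    by move: EX0; rewrite unlock => ->; rewrite mule0 adde0.
  apply: le_integral => //.
  - exact: integrableD.
  - apply/integrableP; split; first exact: measurable_expRM.
    by under eq_integral do rewrite gee0_abs ?lee_fin ?expR_ge0//; rewrite h ltry.
  - by move=> w _; rewrite -EFinM -EFinD lee_fin expR_ge1Dx.
have m0 : m = 0%R.
  apply/eqP; apply: contraT => m0.
  (* the minimiser of the polynomial [quad] with [s ^+ 2] replaced by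
     [1 + s ^+ 2], so that it exists for [s = 0] too *)
  pose a : R := (- m / (1 + s ^+ 2))%R.
  have s1 : (0 < 1 + s ^+ 2)%R by rewrite ltr_wpDr ?sqr_ge0.
  have := quad a.
  have -> : (a * m + a ^+ 2 * s ^+ 2 / 2 =
             - (m ^+ 2 / (1 + s ^+ 2) ^+ 2) * (1 + s ^+ 2 / 2))%R.
    by rewrite /a; field; rewrite gt_eqF.
  rewrite leNgt mulNr oppr_lt0 mulr_gt0//.
    by apply: divr_gt0; [rewrite exprn_even_gt0|rewrite exprn_gt0].
  by rewrite ltr_wpDr// divr_ge0 ?sqr_ge0.
have EX2 : \int[P]_w (X w ^+ 2)%:E = v%:E.
  by rewrite -VX varianceE// EX0 expe2 mule0 sube0 unlock; apply: eq_integral.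
have sv : (s ^+ 2 <= v)%R.
  pose K := expR (2 * s ^+ 2).
  have K0 : (0 < K)%R := expR_gt0 _.
  have key a : (0 < a <= 1)%R -> (s ^+ 2 <= v + 12 * a * K)%R.
    move=> /andP[a0 a1].
    have mexp c := @measurable_expRM X c mX.
    have mX2 : measurable_fun [set: T] (fun w => (X w ^+ 2)%:E).
      by apply/measurable_EFinP; exact: measurable_funX.
    have mc : measurable_fun [set: T] (fun w => (cst 2%R w : R)%:E).
      by apply/measurable_EFinP; exact: measurable_cst.
    have mee : measurable_fun [set: T]
        (fun w => (expR (2 * X w))%:E + (expR (-2 * X w))%:E).
      by apply: emeasurable_funD; exact: mexp.
    have m1 : measurable_fun [set: T] (fun w => (a ^+ 2)%:E * (X w ^+ 2)%:E).
      exact: emeasurable_funM.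
    have m2 : measurable_fun [set: T] (fun w => (6 * a ^+ 3)%:E *
        ((expR (2 * X w))%:E + (expR (-2 * X w))%:E)).
      exact: emeasurable_funM.
    have : \int[P]_w ((expR (a * X w))%:E + (expR (- a * X w))%:E) <=
      \int[P]_w ((cst 2%R w)%:E + ((a ^+ 2)%:E * (X w ^+ 2)%:E +
         (6 * a ^+ 3)%:E * ((expR (2 * X w))%:E + (expR (-2 * X w))%:E))).
      apply: ge0_le_integral => //.
      - by move=> w _; rewrite -EFinD lee_fin addr_ge0 ?expR_ge0.
      - by apply: emeasurable_funD; exact: mexp.
      - by do 2 apply: emeasurable_funD => //.
      - move=> w _; rewrite -!EFinD -?EFinM -?EFinD lee_fin.
        by rewrite addrA !mulNr expR_symD_le// (ltW a0) a1.
    have a60 : (0 <= 6 * a ^+ 3)%R by rewrite mulr_ge0 ?exprn_ge0 ?ltW.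
    rewrite ge0_integralD//; try exact: mexp.
    rewrite !h.
    have n1 w : 0 <= (a ^+ 2)%:E * (X w ^+ 2)%:E.
      by rewrite mule_ge0// lee_fin sqr_ge0.
    have n2 w : 0 <= (expR (2 * X w))%:E + (expR (-2 * X w))%:E.
      by rewrite adde_ge0// lee_fin expR_ge0.
    have n3 w : 0 <= (6 * a ^+ 3)%:E *
        ((expR (2 * X w))%:E + (expR (-2 * X w))%:E).
      by rewrite mule_ge0// lee_fin.
    rewrite ge0_integralD//; last 2 first.
    - by move=> w _; rewrite adde_ge0.
    - exact: emeasurable_funD.
    rewrite ge0_integralD//.
    rewrite ge0_integralZl//; [|by move=> w _; rewrite lee_fin sqr_ge0|
      by rewrite lee_fin sqr_ge0].
    rewrite ge0_integralZl//.
    have c2 : \int[P]_w (cst 2%R w : R)%:E = 2%:E.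
      by rewrite /= integral_cst//= probability_setT mule1.
    rewrite ge0_integralD//; try exact: mexp.
    rewrite !h EX2 c2.
    rewrite -!EFinD -?EFinM -?EFinD lee_fin m0 !mulr0 !add0r !sqrrN.
    rewrite (_ : 2 ^+ 2 * s ^+ 2 / 2 = 2 * s ^+ 2)%R; last by field.
    have := expR_ge1Dx (a ^+ 2 * s ^+ 2 / 2); rewrite -/K => h1 h2.
    rewrite -(ler_pM2l (_ : 0 < a ^+ 2)%R) ?exprn_gt0//.
    have -> : (a ^+ 2 * (v + 12 * a * K) =
      a ^+ 2 * v + 6 * a ^+ 3 * (K + K))%R by ring.
    by lra.
    by move=> w _; rewrite lee_fin.
  apply/ler_addgt0Pr => e e0.
  pose a := (Num.min 1 (e / (12 * K)))%R.
  have a0 : (0 < a)%R by rewrite lt_min ltr01 divr_gt0// mulr_gt0.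
  have := key a; rewrite a0 ge_min lexx/= => /(_ isT)/le_trans; apply.
  rewrite lerD2l mulrAC -ler_pdivlMl ?mulr_gt0// mulrC.
  by rewrite /a ge_min lexx orbT.
split => // a; rewrite h m0 mulr0 add0r lee_fin ler_expR.
by rewrite ler_wpM2r// ler_wpM2l ?sqr_ge0.
Qed.

End SubGaussian.

(** * Stability of sub-Gaussian bounds *)

Section SubGaussianClosure.
Local Open Scope ereal_scope.
Context {R : realType} {d : measure_display} {T : measurableType d}
  (P : probability T R).

Lemma subgaussianZ (X : T -> R) (v c : R) :
  subgaussian P X v -> subgaussian P (fun w => c * X w)%R (c ^+ 2 * v)%R.
Proof.
move=> [mX Xv]; split; first exact: measurable_funM.
move=> a; under eq_integral do rewrite mulrA.
by rewrite mulrA -exprMn.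
Qed.

Lemma subgaussian_le (X : T -> R) (u v : R) : (u <= v)%R ->
  subgaussian P X u -> subgaussian P X v.
Proof.
move=> uv [mX Xu]; split=> // a; apply: (le_trans (Xu a)).
by rewrite lee_fin ler_expR ler_wpM2r// ler_wpM2l// sqr_ge0.
Qed.

(** Jensen's inequality, from the tangent line of the exponential at the
barycenter. *)
Lemma expR_convex_sum (n : nat) (p x : 'I_n -> R) :
  (forall i, 0 <= p i)%R -> (\sum_i p i = 1)%R ->
  (expR (\sum_i p i * x i) <= \sum_i p i * expR (x i))%R.
Proof.
move=> p0 p1; set c := (\sum_i p i * x i)%R.
have -> : expR c = (\sum_i p i * (expR c * (1 + (x i - c))))%R.
  under eq_bigr do rewrite mulrCA.
  rewrite -mulr_sumr; under eq_bigr do rewrite mulrDr mulr1 mulrBr.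
  by rewrite big_split/= sumrB p1 -mulr_suml p1 mul1r -/c subrr addr0 mulr1.
apply: ler_sum => i _; apply: ler_wpM2l => //.
have -> : expR (x i) = (expR c * expR (x i - c))%R.
  by rewrite -expRD addrC subrK.
by rewrite ler_wpM2l ?expR_ge0// expR_ge1Dx.
Qed.

Lemma subgaussian_convex (n : nat) (p : 'I_n -> R) (X : 'I_n -> T -> R) (v : R) :
  (forall i, 0 <= p i)%R -> (\sum_i p i = 1)%R ->
  (forall i, subgaussian P (X i) v) ->
  subgaussian P (fun w => \sum_i p i * X i w)%R v.
Proof.
move=> p0 p1 Xv; have mX i : measurable_fun [set: T] (X i) by case: (Xv i).
split.
  by apply: measurable_sum => i; exact: measurable_funM.
move=> a; apply: (@le_trans _ _
  (\int[P]_w (\sum_(i < n) (p i)%:E * (expR (a * X i w))%:E))).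
  apply: ge0_le_integral => //.
  - by apply: measurable_expRM; apply: measurable_sum => i; exact: measurable_funM.
  - apply: emeasurable_sum => i; apply: emeasurable_funM => //.
    exact: measurable_expRM.
  - move=> w _.
    under [leRHS]eq_bigr do rewrite -EFinM.
    rewrite sumEFin lee_fin mulr_sumr.
    under [X in (expR X <= _)%R]eq_bigr do rewrite mulrCA.
    exact: expR_convex_sum.
have mi i : measurable_fun [set: T] (fun w => (p i)%:E * (expR (a * X i w))%:E).
  by apply: emeasurable_funM => //; exact: measurable_expRM.
have pi0 i w : 0 <= (p i)%:E * (expR (a * X i w))%:E.
  by rewrite mule_ge0// lee_fin ?expR_ge0.
rewrite ge0_integral_sum//.
apply: (@le_trans _ _ (\sum_(i < n) (p i)%:E * (expR (a ^+ 2 * v / 2))%:E)).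
  apply: lee_sum => i _; rewrite ge0_integralZl ?lee_fin//.
  - by apply: lee_wpmul2l; [rewrite lee_fin|case: (Xv i)].
  - exact: measurable_expRM.
under eq_bigr do rewrite -EFinM.
by rewrite sumEFin lee_fin -mulr_suml p1 mul1r.
Qed.

(** Fatou's lemma applied to the exponentials. *)
Lemma subgaussian_cvg (X_ : nat -> T -> R) (X : T -> R) (v : R) :
  (forall n, subgaussian P (X_ n) v) ->
  (forall w, X_ n w @[n --> \oo] --> X w) ->
  subgaussian P X v.
Proof.
move=> Xv XX; have mX n : measurable_fun [set: T] (X_ n) by case: (Xv n).
split; first by apply: (measurable_fun_cvg mX) => w _; exact: XX.
move=> a.
have cv w : (expR (a * X_ n w))%:E @[n --> \oo] --> (expR (a * X w))%:E.
  apply: cvg_EFin; first by near=> n.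
  apply: continuous_cvg; first exact: continuous_expR.
  by apply: cvgMl_tmp; exact: XX.
have -> : \int[P]_w (expR (a * X w))%:E =
    \int[P]_w limn_einf (fun n => (expR (a * X_ n w))%:E).
  by apply: eq_integral => w _; rewrite (cvg_limn_einf_sup (cv w)).
apply: (le_trans (fatou _ _ _ _)) => //.
- by move=> n; exact: measurable_expRM.
rewrite limn_einf_lim; apply: lime_le; first exact: is_cvg_einfs.
apply: nearW => n; apply: le_trans (proj2 (Xv n) a).
by apply: ereal_inf_lbound; exists n => /=.
Unshelve. all: by end_near. Qed.

End SubGaussianClosure.

(** * Increments of fractional Brownian motion *)

Section FractionalBrownianMotion.
Local Open Scope ereal_scope.
Context {R : realType} {d : measure_display} {T : measurableType d}
  {P : probability T R}.
Variables (H : R) (b : R -> {RV P >-> R}).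
Hypothesis H0 : (0 < H)%R.
Hypothesis fb : fractional_brownian_motion H b.

Let gb : gaussian_process b. Proof. by case: fb. Qed.
Let Eb t : (0 <= t)%R -> 'E_P[b t] = 0. Proof. by case: fb => _ + _ _; exact. Qed.
Let cb s t : (0 <= s)%R -> (0 <= t)%R -> covariance P (b t) (b s) =
          (2^-1 * (t `^ (2 * H) + s `^ (2 * H) - `|t - s| `^ (2 * H)))%:E.
Proof. by case: fb => _ _ + _; exact. Qed.

Lemma fbm_variance t : (0 <= t)%R -> 'V_P[b t] = (t `^ (2 * H))%:E.
Proof.
move=> t0; rewrite /variance cb// subrr normr0 powR0; last first.
  by rewrite mulf_neq0// gt_eqF.
by rewrite subr0; congr EFin; field.
Qed.

Lemma fbm_gaussian t : (0 <= t)%R -> gaussian_rv P (b t).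
Proof.
move=> t0; have := @gb 1%N (fun=> t) (fun=> 1%R) (fun=> t0).
by under eq_fun do rewrite big_ord1 mul1r.
Qed.

Lemma fbm_subgaussian t : (0 <= t)%R -> subgaussian P (b t) (t `^ (2 * H))%R.
Proof.
move=> t0; apply: centered_gaussian_subgaussian.
- exact: fbm_gaussian.
- exact: Eb.
- exact: fbm_variance.
Qed.

Lemma fbm_increment_subgaussian s t : (0 <= s)%R -> (0 <= t)%R ->
  subgaussian P (fun w => b t w - b s w)%R (`|t - s| `^ (2 * H))%R.
Proof.
move=> s0 t0.
have t2 : (b t : T -> R) \in Lfun P 2%:E.
  exact/gaussian_rv_Lfun2/fbm_gaussian.
have s2 : (b s : T -> R) \in Lfun P 2%:E.
  exact/gaussian_rv_Lfun2/fbm_gaussian.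
apply: centered_gaussian_subgaussian.
- have := @gb 2%N (fun i => if i == ord0 then t else s)
    (fun i => if i == ord0 then 1 else -1)%R.
  under eq_fun do rewrite big_ord_recl big_ord1/= mul1r mulN1r.
  by apply => i; case: ifP.
- rewrite (expectationB (X := b t) (Y := b s)); [|exact: Lfun2_Lfun1..].
  by rewrite !Eb// subee.
- rewrite (varianceB (X := b t) (Y := b s))// !fbm_variance// cb//.
  by rewrite -EFinM -!EFinD; congr EFin; field.
Qed.

End FractionalBrownianMotion.

(** * Riemann-Stieltjes sums for the pathwise integral *)

(** The Heine-Cantor theorem, by the covering form of compactness applied to the
filter of positive radii tending to 0. *)
Lemma compact_uniform_continuity (R : realType) (A : set R) (f : R -> R) :
  compact A -> {within A, continuous f} -> forall e, 0 < e ->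
  exists2 r, 0 < r &
    forall x y, A x -> A y -> `|x - y| < r -> `|f x - f y| < e.
Proof.
move=> /compact_near_coveringP cA cf e e0.
have := cA _ (0^'+ : set_system R)
  (fun r x => A x -> forall y, A y -> `|x - y| < r -> `|f x - f y| < e) _.
case.
- move=> x Ax.
  have /subspace_continuousP/(_ x Ax)/cvgrPdist_lt/(_ (e / 2)) := cf.
  rewrite divr_gt0// => /(_ isT); rewrite near_withinE => /nbhs_ballP[r/= r0 hr].
  have r2 : 0 < r / 2 by rewrite divr_gt0.
  exists (ball x (r / 2), [set d | d < r / 2]); first split => /=.
  + exact: nbhsx_ballx.
  + exact: nbhs_right_lt.
  move=> [x' d]/= [xx' dr] Ax' y Ay x'y.
  have h1 : `|f x - f x'| < e / 2.
    by apply: hr => //; apply: le_ball xx'; rewrite ler_pdivrMr//; lra.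
  have h2 : `|f x - f y| < e / 2.
    apply: hr => //; rewrite /ball/=.
    rewrite -(subrKA x') (le_lt_trans (ler_normD _ _))//.
    by rewrite (splitr r) ltrD// (lt_trans x'y).
  rewrite -(subrKA (f x)) (le_lt_trans (ler_normD _ _))// (splitr e) ltrD//.
  by rewrite distrC.
- move=> r /= r0 hr; exists (r / 2); first by rewrite divr_gt0.
  move=> x y Ax Ay xy; apply: (hr (r / 2) _ _ x) => //=.
  + by rewrite sub0r normrN gtr0_norm ?divr_gt0//; lra.
  + by rewrite divr_gt0.
Qed.

Section RiemannSums.
Context {R : realType}.
Implicit Types (l t s x : R) (b : R -> R) (n i : nat).

Definition exp_kernel l t s : R := expR (- l * (t - s)).

Lemma is_derive_exp_kernel l t s :
  is_derive s 1 (exp_kernel l t) (l * exp_kernel l t s).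
Proof.
have h : is_derive s 1 (fun x => - l * (t - x)) l.
  have h1 : is_derive s (1 : R) ((- l) \*: (cst t - (id : R -> R))) ((- l) *: (0 - 1)).
    exact: is_deriveZ.
  apply: (is_derive_eq h1).
  by rewrite sub0r -[LHS]/(- l * - 1) mulrNN mulr1.
rewrite mulrC.
exact: (@is_derive1_comp R (@expR R) (fun x => - l * (t - x)) s _ _ _ h).
Qed.

Lemma derive1_exp_kernel l t : (exp_kernel l t)^`()%classic =
  (fun s => l * exp_kernel l t s).
Proof.
apply/funext => s; rewrite derive1E.
exact: (@derive_val _ _ _ _ _ _ _ (is_derive_exp_kernel l t s)).
Qed.

Lemma continuous_exp_kernel l t : continuous (exp_kernel l t).
Proof.
move=> s; apply: differentiable_continuous; apply/derivable1_diffP.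
exact: (@ex_derive _ _ _ _ _ _ _ (is_derive_exp_kernel l t s)).
Qed.

Lemma exp_kernel_le1 l t s : 0 <= l -> s <= t -> exp_kernel l t s <= 1.
Proof.
move=> l0 st; rewrite /exp_kernel -[leRHS]expR0 ler_expR mulNr oppr_le0.
by rewrite mulr_ge0// subr_ge0.
Qed.

Definition grid_point t n i : R := t * i%:R / n.+1%:R.

Lemma grid_pointS t n i :
  grid_point t n i.+1 - grid_point t n i = t / n.+1%:R.
Proof.
rewrite /grid_point -mulrBl -mulrBr -addn1 natrD [_ + 1]addrC addrK.
by rewrite mulr1.
Qed.

Lemma grid_point_last t n : grid_point t n n.+1 = t.
Proof. by rewrite /grid_point mulfK. Qed.

Lemma grid_point0 t n : grid_point t n 0 = 0.
Proof. by rewrite /grid_point mulr0 mul0r. Qed.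

Lemma grid_point_itv t n i : 0 <= t -> (i <= n.+1)%N ->
  0 <= grid_point t n i <= t.
Proof.
move=> t0 i_n; rewrite /grid_point !mulr_ge0 ?invr_ge0//=.
by rewrite ler_pdivrMr// ler_wpM2l// ler_nat.
Qed.

(** Integration by parts carried over to the grid: the derivative of the kernel is
integrated exactly on each cell, [b] being frozen at the left end. *)
Definition stieltjes_sum l t b n : R := exp_kernel l t t * b t -
  \sum_(i < n.+1) (exp_kernel l t (grid_point t n i.+1) -
     exp_kernel l t (grid_point t n i)) * b (grid_point t n i).

(** On a cell [u, v] of the grid, the mean value theorem for [F - K * b u], where
[F] is the primitive of the integrand and [K] the kernel, bounds the error by the
length of the cell times [l] times the oscillation of [b]; uniform continuity
concludes. *)
Lemma stieltjes_sum_cvg l t b : 0 <= l -> 0 <= t ->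
  {within `[0, +oo[, continuous b} ->
  stieltjes_sum l t b n @[n --> \oo] --> path_integral (exp_kernel l t) b t.
Proof.
move=> l0 t0 cb; apply: cvgB; first exact: cvg_cst.
rewrite derive1_exp_kernel.
pose f x := l * exp_kernel l t x * b x.
pose F x := \int[lebesgue_measure]_(s in `[0, x]) f s.
rewrite -/(F t).
have cbt u : {within `[0, u], continuous b}.
  apply: continuous_subspaceW cb => x /=.
  by rewrite !in_itv/= => /andP[-> _].
have cbx x : 0 < x -> {for x, continuous b}.
  move=> x0; apply: (@within_continuous_continuous _ _ _ 0 (x + 1)) => //.
  - by rewrite addr_gt0.
  - by rewrite in_itv/= x0 ltrDl ltr01.
have ckx x : {for x, continuous (fun y => l * exp_kernel l t y)}.
  by apply: cvgMl_tmp; exact: continuous_exp_kernel.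
have cf u : {within `[0, u], continuous f}.
  move=> x; apply: cvgM; last exact: cbt.
  exact: (continuous_subspaceT ckx).
have fint u : lebesgue_measure.-integrable `[0, u] (EFin \o f).
  by apply: continuous_compact_integrable; [exact: segment_compact|exact: cf].
have dF x : 0 < x -> is_derive x 1 F (f x).
  move=> x0.
  have [dFx F'x] := @continuous_FTC1_closed _ f 0 x (x + 1)
    (ltr_pwDr ltr01 (lexx x)) (fint _) x0 (cvgM (ckx x) (cbx _ x0)).
  by apply: DeriveDef => //; rewrite -derive1E.
have cF : {within `[0, t], continuous F}.
  exact: parameterized_integral_continuous.
have step e u v : 0 <= u -> u <= v -> v <= t ->
    (forall x, u <= x <= v -> `|b x - b u| <= e) ->
    `|F v - F u - (exp_kernel l t v - exp_kernel l t u) * b u| <= l * e * (v - u).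
  move=> u0 uv vt be.
  pose G x := F x - exp_kernel l t x * b u.
  have dG x : x \in `]u, v[ -> is_derive x 1 G (f x - l * exp_kernel l t x * b u).
    rewrite in_itv/= => /andP[ux xv].
    have hF := dF _ (le_lt_trans u0 ux).
    have hK := is_derive_exp_kernel l t x.
    apply: is_derive_eq; rewrite scaler0 add0r.
    by congr (_ - _); rewrite -[LHS]/(b u * _) mulrC.
  have cG : {within `[u, v], continuous G}.
    apply: within_continuousB.
      apply: continuous_subspaceW cF => x /=; rewrite !in_itv/= => /andP[ux xv].
      by rewrite (le_trans u0 ux) (le_trans xv vt).
    apply: continuous_subspaceT => x; apply: cvgMr_tmp.
    exact: continuous_exp_kernel.
  have [c /[!in_itv]/= cuv Guv] := MVT_segment uv dG cG.
  have -> : F v - F u - (exp_kernel l t v - exp_kernel l t u) * b u = G v - G u.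
    by rewrite /G; ring.
  rewrite Guv /f -mulrBr normrM (ger0_norm (_ : 0 <= v - u)) ?subr_ge0//.
  rewrite ler_wpM2r ?subr_ge0// normrM ler_pM ?be//.
  rewrite ger0_norm ?mulr_ge0 ?expR_ge0// ler_piMr//.
  by apply: exp_kernel_le1 => //; case/andP: cuv => _ /le_trans; apply.
apply/cvgrPdist_le => e e0.
have lt1 : 0 < l * t + 1 by rewrite ltr_wpDl// mulr_ge0.
have [r r0 br] := compact_uniform_continuity (@segment_compact R 0 t) (cbt t)
  (divr_gt0 e0 lt1).
near=> n.
have nr : t / n.+1%:R < r.
  rewrite ltr_pdivrMr// mulrC -ltr_pdivrMr//.
  apply: (@lt_le_trans _ _ n%:R); last by rewrite ler_nat.
  by near: n; exact: nbhs_infty_gtr.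
have -> : F t = \sum_(i < n.+1) (F (grid_point t n i.+1) - F (grid_point t n i)).
  rewrite -(big_mkord xpredT (fun i => F (grid_point t n i.+1) - F (grid_point t n i))).
  rewrite telescope_sumr// grid_point_last grid_point0.
  by rewrite [F 0]/F set_itv1 Rintegral_set1 subr0.
rewrite -sumrB (le_trans (ler_norm_sum _ _ _))//.
apply: (@le_trans _ _ (\sum_(i < n.+1) l * (e / (l * t + 1)) * (t / n.+1%:R))).
  apply: ler_sum => i _; rewrite -(grid_pointS t n i).
  have /andP[i0 it] := @grid_point_itv t n i t0 (ltnW (ltn_ord i)).
  have /andP[i10 i1t] := @grid_point_itv t n i.+1 t0 (ltn_ord i).
  have ii : grid_point t n i <= grid_point t n i.+1.
    by rewrite -subr_ge0 grid_pointS divr_ge0.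
  apply: step => // x /andP[ix xi].
  apply/ltW/br => /=; rewrite ?in_itv/=.
  - by rewrite (le_trans i0 ix) (le_trans xi i1t).
  - by rewrite i0 it.
  - rewrite ger0_norm ?subr_ge0//; apply: le_lt_trans nr.
    by rewrite -(grid_pointS t n i) lerD2r.
rewrite sumr_const card_ord -[X in X <= _]mulr_natl.
have -> : n.+1%:R * (l * (e / (l * t + 1)) * (t / n.+1%:R)) =
  (l * t) * e / (l * t + 1) by field; rewrite !gt_eqF.
rewrite ler_pdivrMr// mulrC ler_wpM2l ?(ltW e0)//.
by rewrite lerDl.
Unshelve. all: by end_near. Qed.

End RiemannSums.

(** * Size of one coefficient *)

Section CoefficientBound.
Context {R : realType} {d : measure_display} {T : measurableType d}
  {P : probability T R}.

(** The triangle inequality for the sub-Gaussian norm: the sum is a convex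
combination, with weights [c i * tau i / W], of variables rescaled to the common
standard deviation [W]. *)
Lemma subgaussian_weighted_sum (n : nat) (c tau : 'I_n -> R) (Y : 'I_n -> T -> R)
    (M : R) :
  (forall i, 0 <= c i) -> (forall i, 0 < tau i) ->
  0 < \sum_i c i * tau i <= M ->
  (forall i, subgaussian P (Y i) (tau i ^+ 2)) ->
  subgaussian P (fun w => \sum_i c i * Y i w) (M ^+ 2).
Proof.
move=> c0 tau0 /andP[]; set W := \sum_i _ => W0 WM Ytau.
apply: (@subgaussian_le _ _ _ _ _ (W ^+ 2)).
  by rewrite ler_sqr ?nnegrE ?(le_trans _ WM)// ltW.
have -> : (fun w => \sum_i c i * Y i w) =
    (fun w => \sum_i (c i * tau i / W) * (W / tau i * Y i w)).
  apply/funext => w; apply: eq_bigr => i _.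
  by field; rewrite !gt_eqF.
apply: subgaussian_convex.
- by move=> i; rewrite divr_ge0// ?mulr_ge0// ltW.
- by rewrite -mulr_suml divff// gt_eqF.
- move=> i; have := subgaussianZ (W / tau i) (Ytau i).
  by rewrite -exprMn divfK// gt_eqF.
Qed.

Lemma powR_le1D (H x : R) : 0 <= H <= 1 -> 0 <= x -> x `^ H <= 1 + x.
Proof.
move=> /andP[H0 H1] x0; have [x1|/ltW x1] := leP x 1.
  rewrite (@le_trans _ _ (1 `^ H))//.
    by apply: ge0_ler_powR => //; rewrite nnegrE.
  by rewrite powR1 lerDl.
rewrite (@le_trans _ _ (x `^ 1))//; first exact: ler_powR.
by rewrite powRr1// lerDr.
Qed.

(** The right-hand side never vanishes, unlike [u `^ H]; this removes the singularity
at [s = t] when increments are normalised. *)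
Lemma powR_le_affine (H l u : R) : 0 <= H <= 1 -> 0 < l -> 0 <= u ->
  u `^ H <= l `^ (- H) * (1 + l * u).
Proof.
move=> H01 l0 u0; have -> : u = l^-1 * (l * u) by rewrite mulKf// gt_eqF.
rewrite powRM ?invr_ge0 ?mulr_ge0 ?(ltW l0)// mulVKf ?gt_eqF//.
rewrite -powR_inv1 ?(ltW l0)// -powRrM mulN1r.
by rewrite ler_wpM2l ?powR_ge0// powR_le1D// mulr_ge0// ltW.
Qed.

(** The function [x |-> exp (- l * (t - x)) * (2 + l * (t - x))] is a primitive of
the derivative of the kernel times [1 + l * (t - x)], and for [l >= 0] this
factor decreases in [x]: on a cell it is at least its value at the right end.  The
bound telescopes when summed over a grid. *)
Lemma exp_kernel_stepM_le (l t u v : R) : u <= v ->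
  (exp_kernel l t v - exp_kernel l t u) * (1 + l * (t - v)) <=
  exp_kernel l t v * (2 + l * (t - v)) - exp_kernel l t u * (2 + l * (t - u)).
Proof.
move=> uv.
have -> : exp_kernel l t u = exp_kernel l t v * expR (- (l * (v - u))).
  by rewrite /exp_kernel -expRD; congr expR; ring.
set a := exp_kernel l t v; set E := expR _.
have a0 : 0 <= a by exact: expR_ge0.
have E1 : E * (1 + l * (v - u)) <= 1.
  have EE : E * expR (l * (v - u)) = 1 by rewrite -expRD addNr expR0.
  by rewrite -[leRHS]EE ler_wpM2l ?expR_ge0// expR_ge1Dx.
rewrite -subr_ge0.
have -> : a * (2 + l * (t - v)) - a * E * (2 + l * (t - u)) -
  (a - a * E) * (1 + l * (t - v)) = a * (1 - E * (1 + l * (v - u))) by ring.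
by rewrite mulr_ge0// subr_ge0.
Qed.

(** The boundary term of the integration by parts is telescoped over the cells. *)
Lemma stieltjes_sum_increments (l t : R) (b : R -> R) n :
  stieltjes_sum l t b n = exp_kernel l t 0 * b t +
  \sum_(i < n.+1) (exp_kernel l t (grid_point t n i.+1) -
     exp_kernel l t (grid_point t n i)) * (b t - b (grid_point t n i)).
Proof.
under eq_bigr do rewrite mulrBr.
rewrite sumrB -mulr_suml.
rewrite -(big_mkord xpredT (fun i => exp_kernel l t (grid_point t n i.+1) -
     exp_kernel l t (grid_point t n i))).
rewrite telescope_sumr// grid_point_last grid_point0 /stieltjes_sum.
ring.
Qed.

(** The discrete counterpart of the bound by 2 of the total mass of the weight
[1 + l * (t - s)] under the probability that puts mass [exp (- l * t)] at 0 and
has density [l * exp (- l * (t - s))] on [0, t].  Evaluating the weight at left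
ends costs [l * t / n.+1 <= 1] more. *)
Lemma stieltjes_weights_le (l t : R) n : 0 <= l -> 0 <= t -> l * t <= n.+1%:R ->
  exp_kernel l t 0 * (1 + l * t) +
  \sum_(i < n.+1) (exp_kernel l t (grid_point t n i.+1) -
     exp_kernel l t (grid_point t n i)) * (1 + l * (t - grid_point t n i)) <= 3.
Proof.
move=> l0 t0 ltn; set s := grid_point t n.
have tel (f : R -> R) : \sum_(i < n.+1) (f (s i.+1) - f (s i)) = f t - f 0.
  rewrite -(big_mkord xpredT (fun i => f (s i.+1) - f (s i))) telescope_sumr//.
  by rewrite /s grid_point_last grid_point0.
have h1 : l * (t / n.+1%:R) <= 1 by rewrite mulrA ler_pdivrMr// mul1r.
have K1 : exp_kernel l t t = 1 by rewrite /exp_kernel subrr mulr0 expR0.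
have K0 : 0 <= exp_kernel l t 0 by exact: expR_ge0.
pose G x := exp_kernel l t x * (2 + l * (t - x)) + exp_kernel l t x.
apply: (@le_trans _ _ (exp_kernel l t 0 * (1 + l * t) +
    \sum_(i < n.+1) (G (s i.+1) - G (s i)))).
  rewrite lerD2l; apply: ler_sum => i _.
  have si : s i.+1 - s i = t / n.+1%:R := grid_pointS t n i.
  have sii : s i <= s i.+1 by rewrite -subr_ge0 si divr_ge0.
  have D0 : 0 <= exp_kernel l t (s i.+1) - exp_kernel l t (s i).
    rewrite subr_ge0 ler_expR !mulNr lerN2 ler_wpM2l//; lra.
  have := exp_kernel_stepM_le l t sii.
  have h2 : l * (t - s i) = l * (t - s i.+1) + l * (t / n.+1%:R).
    by rewrite -si; ring.
  have := ler_wpM2l D0 h1.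
  rewrite /G h2.
  move: (exp_kernel l t (s i.+1)) (exp_kernel l t (s i)) (l * (t - s i.+1))
    (l * (t / n.+1%:R)) => a1 a2 A L hL hA.
  have -> : (a1 - a2) * (1 + (A + L)) = (a1 - a2) * (1 + A) + (a1 - a2) * L.
    by ring.
  by apply: le_trans (lerD hA hL) _; rewrite le_eqVlt; apply/orP; left;
    apply/eqP; ring.
rewrite tel /G K1 subrr subr0 mulr0; lra.
Qed.

(** The central estimate: the Ornstein-Uhlenbeck coefficient with rate [l] has
standard deviation of order [l `^ (- H)], at all times. *)
Lemma path_integral_subgaussian (H : R) (b : R -> {RV P >-> R}) (l t : R) :
  0 < H < 1 -> fractional_brownian_motion H b -> 0 < l -> 0 <= t ->
  subgaussian P (fun w => path_integral (exp_kernel l t) (fun s => b s w) t)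
    ((3 * l `^ (- H)) ^+ 2).
Proof.
move=> /andP[H0 H1] fb l0 t0.
have H01 : 0 <= H <= 1 by rewrite !ltW.
have [N lN] : exists N : nat, l * t <= N%:R.
  by exists (Num.bound (l * t)); apply/ltW/archi_boundP; rewrite mulr_ge0// ltW.
(* the shift by [N] makes the mesh small with respect to [l^-1] *)
apply: (@subgaussian_cvg _ _ _ _
  (fun n w => stieltjes_sum l t (fun s => b s w) (n + N))); last first.
  move=> w.
  have := @stieltjes_sum_cvg _ l t (fun s => b s w) (ltW l0) t0.
  case: fb => _ _ _ /(_ w) cb /(_ cb).
  by rewrite -(cvg_shiftn N).
move=> n; set m := (n + N)%N.
pose s := grid_point t m.
pose tau x := l `^ (- H) * (1 + l * (t - x)).
have ll : 0 < l `^ (- H) by rewrite powR_gt0.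
have tau0 x : x <= t -> 0 < tau x.
  move=> xt; rewrite mulr_gt0// ltr_pwDl// mulr_ge0 ?(ltW l0)//.
  by rewrite subr_ge0.
have tausub x : 0 <= x <= t -> subgaussian P (fun w => b t w - b x w) (tau x ^+ 2).
  move=> /andP[x0 xt].
  apply: subgaussian_le (fbm_increment_subgaussian H0 fb x0 t0).
  rewrite mulrC powRrM (powR_mulrn 2) ?powR_ge0//.
  rewrite ler_sqr ?nnegrE ?powR_ge0 ?(ltW (tau0 _ xt))//.
  by rewrite /tau ger0_norm ?subr_ge0// powR_le_affine// subr_ge0.
have tau0sub : subgaussian P (b t) (tau 0 ^+ 2).
  apply: subgaussian_le (fbm_subgaussian H0 fb t0).
  rewrite mulrC powRrM (powR_mulrn 2) ?powR_ge0//.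
  rewrite ler_sqr ?nnegrE ?powR_ge0 ?(ltW (tau0 _ t0))//.
  by rewrite /tau subr0 powR_le_affine.
have si (i : 'I_m.+1) : 0 <= s i <= t.
  exact: (grid_point_itv t0 (ltnW (ltn_ord i))).
(* the index 0 stands for [b t] itself, the others for the increments *)
pose c (i : 'I_m.+2) := if unlift ord0 i is Some j
  then exp_kernel l t (s j.+1) - exp_kernel l t (s j) else exp_kernel l t 0.
pose ta (i : 'I_m.+2) := if unlift ord0 i is Some j then tau (s j) else tau 0.
pose Y (i : 'I_m.+2) : T -> R := if unlift ord0 i is Some j
  then (fun w => b t w - b (s j) w) else b t.
have -> : (fun w => stieltjes_sum l t (fun s => b s w) m) =
    (fun w => \sum_i c i * Y i w).
  apply/funext => w; rewrite stieltjes_sum_increments [RHS]big_ord_recl.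
  rewrite /c /Y unlift_none; congr (_ + _); apply: eq_bigr => i _.
  by rewrite liftK.
have c0 i : 0 <= c i.
  rewrite /c; case: unliftP => [j _|_]; last exact: expR_ge0.
  rewrite subr_ge0 ler_expR !mulNr lerN2 ler_wpM2l ?(ltW l0)//.
  by rewrite lerD2l lerN2 -subr_ge0 grid_pointS divr_ge0.
have ta0 i : 0 < ta i.
  rewrite /ta; case: unliftP => [j _|_]; apply: tau0 => //.
  by case/andP: (si j).
apply: (subgaussian_weighted_sum c0 ta0).
  have c00 : 0 < c ord0 * ta ord0.
    by rewrite mulr_gt0// /c unlift_none expR_gt0.
  rewrite big_ord_recl ltr_pwDl//=; last first.
    by apply: sumr_ge0 => i _; rewrite mulr_ge0// ltW.
  rewrite /c /ta unlift_none /tau subr0.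
  under eq_bigr do rewrite liftK mulrCA.
  rewrite -mulr_sumr mulrCA -mulrDr mulrC ler_wpM2r ?(ltW ll)//.
  apply: stieltjes_weights_le => //; first exact: ltW.
  by rewrite (le_trans lN)// ler_nat /m leqW// leq_addl.
by move=> i; rewrite /Y /ta; case: unliftP => [j _|_]; [exact: tausub|].
Qed.

End CoefficientBound.

(** * Measurability and independence of the coefficients *)

Section ProcessSigma.
Context {R : realType} {d : measure_display} {T : measurableType d}
  {P : probability T R}.

Lemma process_sigma_measurable (b : R -> {RV P >-> R}) (A : set T) :
  process_sigma b A -> measurable A.
Proof.
apply: smallest_sub.
  split => //.
  - by move=> B mB; apply: measurableD.
  - by move=> F mF; exact: bigcup_measurable.
move=> _ [t [B [t0 mB ->]]]; rewrite -[X in measurable X]setTI.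
exact: measurable_funP.
Qed.

(** The Stieltjes sums only involve finitely many values of the process. *)
Lemma path_integral_process_sigma (b : R -> {RV P >-> R}) (l t : R) (B : set R) :
  0 <= l -> 0 <= t -> (forall w, {within `[0, +oo[, continuous (fun s => b s w)}) ->
  measurable B ->
  process_sigma b
    ((fun w => path_integral (exp_kernel l t) (fun s => b s w) t) @^-1` B).
Proof.
move=> l0 t0 cb mB.
pose G := [set A | exists (t : R) (B : set R),
         [/\ 0 <= t, measurable B & A = b t @^-1` B] ].
have mb s : 0 <= s -> measurable_fun [set: g_sigma_algebraType G] (b s : T -> R).
  move=> s0 _ C mC; rewrite setTI; apply: sub_sigma_algebra.
  by exists s, C.
have mS n : measurable_fun [set: g_sigma_algebraType G]
    (fun w : T => stieltjes_sum l t (fun s => b s w) n).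
  apply: measurable_funB.
    by apply: measurable_funM => //; exact: mb.
  apply: measurable_sum => i; apply: measurable_funM => //; apply: mb.
  by case/andP: (grid_point_itv t0 (ltnW (ltn_ord i))).
have mZ : measurable_fun [set: g_sigma_algebraType G]
    (fun w : T => path_integral (exp_kernel l t) (fun s => b s w) t).
  apply: (measurable_fun_cvg mS) => w _.
  exact: stieltjes_sum_cvg.
have := mZ measurableT B mB.
by rewrite setTI.
Qed.

End ProcessSigma.

Section IndependentProduct.
Context {R : realType} {d : measure_display} {T : measurableType d}
  (P : probability T R).
Variables (I : set nat) (sigma : nat -> set (set T)).
Hypothesis sigma_measurable : forall k A, sigma k A -> measurable A.
Hypothesis sigma_indep : forall (J : {fset nat}) (A : nat -> set T),
    (forall k : nat, k \in J -> I k) ->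
    (forall k : nat, k \in J -> sigma k (A k)) ->
    P (\bigcap_(k in [set` J]) A k) = (\prod_(k <- J) P (A k))%E.

Variables (Z : nat -> T -> R) (F : nat -> R -> R) (m : nat -> R).
Hypothesis Zsigma : forall k B, I k -> measurable B -> sigma k (Z k @^-1` B).
Hypothesis F0 : forall k x, 0 <= F k x.
Hypothesis mF : forall k, measurable_fun [set: R] (F k).
Hypothesis EF : forall k, I k -> (\int[P]_w (F k (Z k w))%:E = (m k)%:E)%E.

(** Independence is a relation between sets.  The induction turns one indicator
after the other into a function: the set [Z i @^-1` B] joins the family [A], and
as [B] varies the relation characterises the weighted image of [P] by [Z i]. *)
Lemma integral_indep_prod_setI (s : seq nat) (J : {fset nat}) (A : nat -> set T) :
  uniq s -> (forall k, k \in s -> I k) -> (forall k, k \in J -> I k) ->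
  (forall k, k \in s -> k \notin J) ->
  (forall k : nat, k \in J -> sigma k (A k)) ->
  (\int[P]_(w in \bigcap_(k in [set` J]) A k)
     (\prod_(k <- s) F k (Z k w))%:E =
   (\prod_(k <- s) m k)%:E * P (\bigcap_(k in [set` J]) A k))%E.
Proof.
elim: s J A => [|i s IH] J A.
  move=> _ _ IJ _ sA; under eq_integral do rewrite big_nil.
  rewrite big_nil integral_cst//.
  apply: fin_bigcap_measurable => // k kJ.
  exact: sigma_measurable (sA _ kJ).
move=> /= /andP[iNs us] Is IJ sJ sA.
have mC : measurable (\bigcap_(k in [set` J]) A k).
  apply: fin_bigcap_measurable => // k kJ.
  exact: sigma_measurable (sA _ kJ).
set C := \bigcap_(k in _) _ in mC *.
have Ii : I i by apply: Is; rewrite mem_head.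
have Is' k : k \in s -> I k by move=> ks; apply: Is; rewrite inE ks orbT.
have mZ k : I k -> measurable_fun [set: T] (Z k).
  move=> Ik _ B mB; rewrite setTI; exact: sigma_measurable (Zsigma Ik mB).
have iNJ : i \notin J by apply: sJ; rewrite mem_head.
have C1 : (P C \is a fin_num)%E by exact: fin_num_measure.
pose g w := \1_C w * \prod_(k <- s) F k (Z k w).
have mg : measurable_fun [set: T] g.
  apply: measurable_funM => //.
  apply: measurable_prod => k ks; apply: (measurableT_comp (mF k)).
  exact/mZ/Is'.
have g0 w : 0 <= g w.
  by rewrite mulr_ge0// prodr_ge0.
pose c := (\prod_(k <- s) m k) * fine (P C).
have m0 k : I k -> 0 <= m k.
  by move=> Ik; rewrite -lee_fin -EF// integral_ge0// => w _; rewrite lee_fin.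
have c0 : 0 <= c.
  rewrite mulr_ge0 ?fine_ge0// big_seq prodr_ge0// => k ks.
  exact/m0/Is'.
transitivity (\int[P]_w ((F i (Z i w))%:E * (g w)%:E))%E.
  rewrite integral_mkcond; apply: eq_integral => w _.
  rewrite /g patchE indicE big_cons; case: ifP => _.
    by rewrite mul1r EFinM.
  by rewrite mul0r mule0.
have mFi : measurable_fun [set: R] (EFin \o F i) by exact/measurable_EFinP.
rewrite (@eq_integral_weighted_image R _ _ _ T T _ P P (Z i) (Z i) g (cst c)
  (EFin \o F i))//.
- transitivity (\int[P]_w (c%:E * (F i (Z i w))%:E))%E.
    by apply: eq_integral => w _; rewrite muleC.
  rewrite ge0_integralZl//=; last 2 first.
  + by apply: (measurableT_comp mFi); exact: mZ.
  + by move=> w _; rewrite lee_fin.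
  rewrite EF// big_cons /c !EFinM fineK//.
  by rewrite muleC muleA.
- exact: mZ.
- exact: mZ.
- by move=> y; rewrite /= lee_fin.
move=> B mB.
have mZB : measurable (Z i @^-1` B) by exact: sigma_measurable (Zsigma Ii mB).
pose A' k := if k == i then Z i @^-1` B else A k.
have J'E : \bigcap_(k in [set` (i |` J)%fset]) A' k = Z i @^-1` B `&` C.
  apply/seteqP; split => [w h|w [h1 h2] k /=].
    split; first by have := h i; rewrite /A' eqxx; apply => /=; rewrite !inE eqxx.
    move=> k /= kJ; have := h k; rewrite /A'; case: eqP => [ki|_].
      by move: iNJ; rewrite -ki kJ.
    by apply => /=; rewrite !inE kJ orbT.
  rewrite /A' !inE; case: eqP => //= _ kJ; exact: h2.
have sA' k : k \in (i |` J)%fset -> sigma k (A' k).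
  rewrite !inE /A'; case: eqP => [-> _|_ /= kJ]; [exact: Zsigma|exact: sA].
have IJ' k : k \in (i |` J)%fset -> I k.
  by rewrite !inE => /orP[/eqP ->//|/IJ].
have := IH (i |` J)%fset A' us Is' IJ' _ sA'.
rewrite J'E => IHB.
transitivity (\int[P]_(w in Z i @^-1` B `&` C) (\prod_(k <- s) F k (Z k w))%:E)%E.
  rewrite integral_mkcondr; apply: eq_integral => w _.
  by rewrite /g patchE indicE; case: ifP => _; rewrite ?mul1r ?mul0r.
rewrite IHB; last first.
  move=> k ks; rewrite !inE negb_or; apply/andP; split.
    by apply: contraNneq iNs => <-.
  by apply: sJ; rewrite inE ks orbT.
rewrite /= integral_cst//=.
rewrite /c EFinM -muleA; congr (_ * _)%E.
rewrite fineK// -J'E sigma_indep// big_fsetU1//= /A' eqxx muleC; congr (_ * _)%E.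
rewrite /C sigma_indep//; apply: eq_big_seq => k kJ.
by case: eqP => // ki; move: iNJ; rewrite -ki kJ.
Qed.

Lemma integral_indep_prod (s : seq nat) :
  uniq s -> (forall k, k \in s -> I k) ->
  (\int[P]_w (\prod_(k <- s) F k (Z k w))%:E = (\prod_(k <- s) m k)%:E)%E.
Proof.
move=> us Is; have := @integral_indep_prod_setI s fset0 (fun=> setT) us Is.
rewrite [X in \bigcap_(k in X) _](_ : _ = set0); last first.
  by apply/seteqP; split.
rewrite bigcap_set0 probability_setT mule1; apply => //.
Qed.

End IndependentProduct.

(** * Sums of independent sub-Gaussian variables and their moments *)

Section SubGaussianSums.
Context {R : realType} {d : measure_display} {T : measurableType d}
  (P : probability T R).

Lemma subgaussian_indep_sum (I : set nat) (sigma : nat -> set (set T))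
    (Z : nat -> T -> R) (v a : nat -> R) (s : seq nat) :
  (forall k A, sigma k A -> measurable A) ->
  (forall (J : {fset nat}) (A : nat -> set T),
    (forall k : nat, k \in J -> I k) ->
    (forall k : nat, k \in J -> sigma k (A k)) ->
    P (\bigcap_(k in [set` J]) A k) = (\prod_(k <- J) P (A k))%E) ->
  (forall k B, I k -> measurable B -> sigma k (Z k @^-1` B)) ->
  (forall k, I k -> subgaussian P (Z k) (v k)) ->
  uniq s -> (forall k, k \in s -> I k) ->
  subgaussian P (fun w => \sum_(k <- s) a k * Z k w) (\sum_(k <- s) a k ^+ 2 * v k).
Proof.
move=> msig indep Zsig Zv us Is; split.
  under eq_fun do rewrite (big_nth 0%N) big_mkord.
  apply: measurable_sum => i; apply: measurable_funM => //.
  by case: (Zv (nth 0%N s i)) => //; apply/Is/mem_nth.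
move=> u.
pose F k x := expR (u * a k * x).
pose m k := fine (\int[P]_w (F k (Z k w))%:E)%E.
have F0 k x : 0 <= F k x by exact: expR_ge0.
have mF k : measurable_fun [set: R] (F k).
  by apply: measurableT_comp => //; exact: measurable_funM.
have Fv k : I k -> (\int[P]_w (F k (Z k w))%:E <=
    (expR (u ^+ 2 * (a k ^+ 2 * v k) / 2))%:E)%E.
  by move=> Ik; rewrite mulrA -exprMn; case: (Zv k Ik) => _; apply.
have EF k : I k -> (\int[P]_w (F k (Z k w))%:E = (m k)%:E)%E.
  move=> Ik; rewrite fineK// ge0_fin_numE ?(le_lt_trans (Fv k Ik)) ?ltry//.
  by apply: integral_ge0 => w _; rewrite lee_fin.
have -> : (\int[P]_w (expR (u * \sum_(k <- s) a k * Z k w))%:E =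
           \int[P]_w (\prod_(k <- s) F k (Z k w))%:E)%E.
  apply: eq_integral => w _; rewrite mulr_sumr.
  by rewrite expR_sum; under eq_bigr do rewrite mulrA.
rewrite (integral_indep_prod msig indep Zsig F0 mF EF us Is) lee_fin.
rewrite mulr_sumr mulr_suml expR_sum big_seq [leRHS]big_seq.
apply: ler_prod => k ks; have Ik := Is _ ks; apply/andP; split.
  by rewrite -lee_fin -EF// integral_ge0// => w _; rewrite lee_fin.
by rewrite -lee_fin -EF// Fv.
Qed.

Definition gaussian_moment_bound (m : nat) : R := 2 * (2 * m)`!%:R * expR 2^-1.

Lemma exprn_le_expR (m : nat) (x : R) : (0 < m)%N ->
  x ^+ (2 * m) <= (2 * m)`!%:R * (expR x + expR (- x)).
Proof.
move=> m0.
have h (z : R) : 0 <= z -> z ^+ (2 * m) <= (2 * m)`!%:R * expR z.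
  move=> z0; rewrite -ler_pdivrMl ?ltr0n ?fact_gt0//.
  have := @expR_ge1Dxn R z (2 * m).-1 z0.
  rewrite prednK ?muln_gt0// mulrC; lra.
have f0 : 0 <= (2 * m)`!%:R :> R by [].
have [x0|x0] := leP 0 x.
  by rewrite (le_trans (h _ x0))// ler_wpM2l// lerDl expR_ge0.
have -> : x ^+ (2 * m) = (- x) ^+ (2 * m) by rewrite !exprM sqrrN.
have nx : 0 <= - x by rewrite oppr_ge0 ltW.
by rewrite (le_trans (h _ nx))// ler_wpM2l// lerDr expR_ge0.
Qed.

(** The bound [x ^ (2 m) <= (2 m)! * (exp x + exp (- x))] is applied to [X / r], whose
Laplace transform at 1 and -1 is at most [exp (1 / 2)]. *)
Lemma subgaussian_moment (X : T -> R) (r : R) (m : nat) : (0 < m)%N -> 0 < r ->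
  subgaussian P X (r ^+ 2) ->
  (\int[P]_w (X w ^+ (2 * m))%:E <= (gaussian_moment_bound m * r ^+ (2 * m))%:E)%E.
Proof.
move=> m0 r0 [mX Xr].
pose C := r ^+ (2 * m) * (2 * m)`!%:R.
have C0 : 0 <= C by rewrite mulr_ge0// exprn_ge0// ltW.
apply: (@le_trans _ _ (\int[P]_w (C%:E *
   ((expR (r^-1 * X w))%:E + (expR (- r^-1 * X w))%:E)))%E).
  apply: ge0_le_integral => //.
  - by move=> w _; rewrite lee_fin exprM exprn_ge0 ?sqr_ge0.
  - by apply/measurable_EFinP; exact: measurable_funX.
  - by apply: emeasurable_funM => //; apply: emeasurable_funD; exact: measurable_expRM.
  - move=> w _; rewrite lee_fin.
    have -> : X w ^+ (2 * m) = r ^+ (2 * m) * (r^-1 * X w) ^+ (2 * m).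
      by rewrite -exprMn mulVKf// gt_eqF.
    rewrite /C -mulrA ler_wpM2l ?exprn_ge0 ?(ltW r0)// mulNr.
    exact: exprn_le_expR.
rewrite ge0_integralZl//; last 2 first.
- by apply: emeasurable_funD; exact: measurable_expRM.
- by move=> w _; rewrite adde_ge0// lee_fin expR_ge0.
rewrite ge0_integralD//; [|exact: measurable_expRM|exact: measurable_expRM].
apply: (@le_trans _ _ (C%:E * ((expR 2^-1)%:E + (expR 2^-1)%:E))%E).
  apply: lee_wpmul2l; first by rewrite lee_fin.
  have rr : r^-1 ^+ 2 * r ^+ 2 / 2 = 2^-1.
    by rewrite -exprMn mulVf ?gt_eqF// expr1n mul1r.
  have := Xr r^-1; have := Xr (- r^-1); rewrite sqrrN rr => h1 h2.
  exact: leeD.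
by rewrite -EFinD -EFinM lee_fin /C /gaussian_moment_bound le_eqVlt; apply/orP;
  left; apply/eqP; ring.
Qed.

End SubGaussianSums.

(** * Sine series controlled on dyadic blocks *)

Section Eigenfunctions.
Context {R : realType}.
Implicit Types (x y : R) (k : nat).

Lemma sin_lipschitz x y : `|sin x - sin y| <= `|x - y|.
Proof.
wlog yx : x y / y <= x.
  move=> H; have [/H//|/ltW /H] := leP y x.
  by rewrite distrC [leRHS]distrC.
have [c _ ->] := @MVT_segment R sin cos y x yx (fun z _ => is_derive_sin z)
  (continuous_subspaceT (@continuous_sin R)).
by rewrite normrM ler_piMl// cos_max.
Qed.

Lemma sqr_eigfun_le2 k x : eigfun k x ^+ 2 <= 2.
Proof.
by rewrite /eigfun exprMn sqr_sqrtr// ler_piMr// -sqr_normr expr_le1// sin_max.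
Qed.

Lemma eigfun_lipschitz k x y :
  `|eigfun k x - eigfun k y| <= 2 * pi * k%:R * `|x - y|.
Proof.
rewrite /eigfun -mulrBr normrM -!mulrA ler_pM//.
  rewrite ger0_norm ?sqrtr_ge0// -[leRHS]ger0_norm// -sqrtr_sqr ler_wsqrtr//.
  by rewrite expr2; lra.
apply: (le_trans (sin_lipschitz _ _)).
by rewrite !mulrA -!mulrBr !normrM normr_nat (ger0_norm (pi_ge0 R)) (mulrC pi).
Qed.

Lemma continuous_eigfun k : continuous (@eigfun R k).
Proof.
move=> x; apply: cvgMl_tmp; apply: continuous_comp; last exact: continuous_sin.
by apply: cvgMl_tmp; exact: cvg_id.
Qed.

Definition sine_sum (c : nat -> R) (n : nat) (x : R) : R :=
  \sum_(1 <= k < n) c k * eigfun k x.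

Lemma continuous_sine_sum c n : continuous (sine_sum c n).
Proof.
apply: continuous_big => // [|k _ x]; first exact: add_continuous.
by apply: cvgMl_tmp; exact: continuous_eigfun.
Qed.

End Eigenfunctions.

Section DyadicBlocks.
Context {R : realType}.
Variables (c : nat -> R) (y q : R).
Hypothesis y0 : 0 <= y.
Hypothesis q12 : 2^-1 <= q < 1.
Hypothesis block_grid : forall j N g : nat, (N <= 2 ^ j)%N -> (g <= 16 ^ j)%N ->
  `|\sum_(2 ^ j <= k < 2 ^ j + N) c k * eigfun k (g%:R / 16 ^+ j)| <= y * q ^+ j.
Hypothesis coef_growth : forall j k : nat, (2 ^ j <= k < 2 ^ j.+1)%N ->
  `|c k| <= 2 ^+ j * y.

Let q0 : 0 <= q. Proof. by case/andP: q12 => h _; rewrite (le_trans _ h)// invr_ge0. Qed.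
Let q1 : q < 1. Proof. by case/andP: q12. Qed.
Let q1' : 0 < 1 - q. Proof. by rewrite subr_gt0. Qed.

(** 1 for the values on the grid, [4 * pi] for the passage from the grid to the
interval. *)
Definition block_const : R := 1 + 4 * pi.

Let D0 : 0 <= block_const.
Proof. by rewrite addr_ge0// mulr_ge0// pi_ge0. Qed.

(** Between two points of the grid of step [16^(-j)], the Lipschitz constants of the
terms, of order [k <= 2 * 2^j], the number [2^j] of terms and the coefficients, of
order [2^j], together cost [16^(-j) * 2^j * 2^j * 2^j = 2^(-j) <= q^j]. *)
Lemma block_le j N x : (N <= 2 ^ j)%N -> 0 <= x <= 1 ->
  `|\sum_(2 ^ j <= k < 2 ^ j + N) c k * eigfun k x| <= block_const * y * q ^+ j.
Proof.
move=> Nj /andP[x0 x1].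
have s0 : 0 < 16 ^+ j :> R by rewrite exprn_gt0.
have sx0 : 0 <= 16 ^+ j * x by rewrite mulr_ge0// ltW.
pose g := Num.truncn (16 ^+ j * x).
have /andP[gx xg] := truncn_itv sx0.
have gj : (g <= 16 ^ j)%N.
  by rewrite -(ler_nat R) natrX (le_trans gx)// ler_piMr// ltW.
set z : R := g%:R / 16 ^+ j.
have xz : `|x - z| <= (16 ^+ j)^-1.
  have -> : x - z = (16 ^+ j * x - g%:R) / 16 ^+ j.
    by rewrite /z; field; rewrite gt_eqF.
  rewrite normrM normfV (ger0_norm (ltW s0)).
  rewrite ler_piMl ?invr_ge0 ?(ltW s0)// ger0_norm ?subr_ge0//.
  by rewrite lerBlDl natr1 ltW.
rewrite -(subrK (\sum_(2 ^ j <= k < 2 ^ j + N) c k * eigfun k z)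
            (\sum_(2 ^ j <= k < 2 ^ j + N) c k * eigfun k x)).
rewrite (le_trans (ler_normD _ _))//.
have -> : block_const * y * q ^+ j = 4 * pi * y * q ^+ j + y * q ^+ j.
  by rewrite /block_const; ring.
apply: lerD; last exact: block_grid.
rewrite -sumrB (le_trans (ler_norm_sum _ _ _))//.
apply: (@le_trans _ _ (\sum_(2 ^ j <= k < 2 ^ j + N) (4 * pi * y / 4 ^+ j))).
  apply: ler_sum_nat => k /andP[k1 k2]; rewrite -mulrBr normrM.
  have kj : (k < 2 ^ j.+1)%N.
    by rewrite expnS mul2n -addnn (leq_trans k2)// leq_add2l.
  have ck : `|c k| <= 2 ^+ j * y by apply: coef_growth; rewrite k1.
  have kR : k%:R <= 2 * 2 ^+ j :> R.
    by rewrite -exprS -natrX ler_nat ltnW.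
  have ek : `|eigfun k x - eigfun k z| <= 2 * pi * (2 * 2 ^+ j) * (16 ^+ j)^-1.
    rewrite (le_trans (eigfun_lipschitz _ _ _))// ler_pM ?mulr_ge0 ?pi_ge0//.
    by rewrite ler_wpM2l// mulr_ge0 ?pi_ge0.
  rewrite (le_trans (ler_pM _ _ ck ek))//.
  have -> : 16 ^+ j = 2 ^+ j * 2 ^+ j * 4 ^+ j :> R.
    by rewrite -!exprMn; congr (_ ^+ _); ring.
  have p2 : 2 ^+ j != 0 :> R by rewrite expf_neq0.
  have p4 : 4 ^+ j != 0 :> R by rewrite expf_neq0.
  by rewrite le_eqVlt; apply/orP; left; apply/eqP; field; rewrite p2 p4.
rewrite sumr_const_nat addKn -[leLHS]mulr_natl.
have h4 : 0 <= 4 * pi * y / 4 ^+ j.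
  by rewrite divr_ge0 ?exprn_ge0// !mulr_ge0// pi_ge0.
apply: (@le_trans _ _ ((2 ^+ j) * (4 * pi * y / 4 ^+ j))).
  by rewrite ler_wpM2r// -natrX ler_nat.
have -> : 4 ^+ j = 2 ^+ j * 2 ^+ j :> R by rewrite -!exprMn; congr (_ ^+ _); ring.
have p2 : 2 ^+ j != 0 :> R by rewrite expf_neq0.
have -> : 2 ^+ j * (4 * pi * y / (2 ^+ j * 2 ^+ j)) = 4 * pi * y * (2^-1) ^+ j.
  by rewrite exprVn; field.
rewrite ler_wpM2l ?mulr_ge0 ?pi_ge0//.
by rewrite lerXn2r ?nnegrE//; case/andP: q12.
Qed.

Let T_ j x := sine_sum c (2 ^ j) x.

Lemma sine_sum_block j N x :
  sine_sum c (2 ^ j + N) x - sine_sum c (2 ^ j) x =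
  \sum_(2 ^ j <= k < 2 ^ j + N) c k * eigfun k x.
Proof.
rewrite /sine_sum (@big_cat_nat _ _ _ (2 ^ j)%N)/= ?expn_gt0 ?leq_addr//.
by rewrite addrAC subrr add0r.
Qed.

(** A bound for the distance between any partial sum past the index [2 ^ j] and the
one at that index, by the geometric series of the blocks. *)
Definition tail_bound j : R := 2 * block_const * y * q ^+ j / (1 - q).

Lemma sine_sum_dyadicB i j x : 0 <= x <= 1 ->
  `|T_ (j + i) x - T_ j x| <= block_const * y * q ^+ j * (1 - q ^+ i) / (1 - q).
Proof.
move=> x01; elim: i => [|i IH].
  by rewrite addn0 subrr normr0 expr0 subrr mulr0 mul0r.
rewrite -(subrKA (T_ (j + i) x)) (le_trans (ler_normD _ _))//.
have h : `|T_ (j + i.+1) x - T_ (j + i) x| <= block_const * y * q ^+ (j + i).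
  rewrite addnS /T_ expnS mul2n -addnn sine_sum_block.
  exact: block_le.
apply: (le_trans (lerD h IH)); rewrite le_eqVlt; apply/orP; left; apply/eqP.
by rewrite exprD exprS; field; rewrite gt_eqF.
Qed.

Lemma sine_sum_dyadic_dist j n x : 0 <= x <= 1 -> (2 ^ j <= n)%N ->
  `|sine_sum c n x - T_ j x| <= tail_bound j.
Proof.
move=> x01 jn.
pose i := (trunc_log 2 n - j)%N.
have n0 : (0 < n)%N by rewrite (leq_trans _ jn)// expn_gt0.
have ji : (j + i)%N = trunc_log 2 n by rewrite subnKC// trunc_log_max.
have n1 : (2 ^ (j + i) <= n)%N by rewrite ji trunc_logP.
have n2 : (n - 2 ^ (j + i) <= 2 ^ (j + i))%N.
  by rewrite leq_subLR addnn -mul2n -expnS ltnW// ji trunc_log_ltn.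
rewrite -(subrKA (T_ (j + i) x)) (le_trans (ler_normD _ _))//.
have h : `|sine_sum c n x - T_ (j + i) x| <= block_const * y * q ^+ (j + i).
  by rewrite -{1}(subnKC n1) sine_sum_block block_le.
apply: (le_trans (lerD h (sine_sum_dyadicB _ _ x01))).
have Dy : 0 <= block_const * y * q ^+ j by rewrite !mulr_ge0// exprn_ge0.
rewrite -subr_ge0.
have -> : tail_bound j - (block_const * y * q ^+ (j + i) +
  block_const * y * q ^+ j * (1 - q ^+ i) / (1 - q)) =
  (block_const * y * q ^+ j) * (1 + q ^+ i.+1) / (1 - q).
  by rewrite /tail_bound exprD exprS; field; rewrite gt_eqF.
by rewrite divr_ge0 ?(ltW q1')// mulr_ge0// addr_ge0// exprn_ge0.
Qed.

Lemma sine_sum_le n x : 0 <= x <= 1 -> (0 < n)%N ->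
  `|sine_sum c n x| <= tail_bound 0.
Proof.
move=> x01 n0; have := @sine_sum_dyadic_dist 0 n x x01 n0.
by rewrite /T_ /sine_sum expn0 [X in _ - X]big_geq// subr0.
Qed.

Lemma tail_bound_cvg0 : tail_bound j @[j --> \oo] --> 0.
Proof.
rewrite /tail_bound (_ : 0 = 2 * block_const * y * 0 / (1 - q)); last first.
  by rewrite mulr0 mul0r.
apply: cvgMr_tmp; apply: cvgMl_tmp; apply: cvg_expr.
by rewrite ger0_norm.
Qed.

(** Cut off outside [0, 1], where alone convergence is controlled, to get a measurable
function on the whole line. *)
Definition sine_limit x : R :=
  limn (fun n => sine_sum c n.+1 x * \1_`[0, 1] x).

Lemma sine_sum_indic_cvg x :
  sine_sum c n.+1 x * \1_`[0, 1] x @[n --> \oo] --> sine_limit x.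
Proof.
suff : cvgn (fun n => sine_sum c n.+1 x * \1_`[0, 1] x) by [].
rewrite indicE; case: (boolP (x \in _)) => xin; last first.
  rewrite mulr0n; under eq_fun do rewrite mulr0; exact: is_cvg_cst.
rewrite mulr1n; under eq_fun do rewrite mulr1.
have x01 : 0 <= x <= 1 by move: xin; rewrite inE/= in_itv/=.
apply/cauchy_cvgP/cauchy_exP => e e0.
have /cvgrPdist_lt/(_ e e0)[j _ hj] := tail_bound_cvg0.
exists (T_ j x).
suff : \forall n \near \oo, ball (T_ j x) e (sine_sum c n.+1 x) by [].
near=> n; rewrite /ball/= distrC.
apply: le_lt_trans (sine_sum_dyadic_dist x01 _) _.
  by apply: leqW; near: n; exact: nbhs_infty_ge.
rewrite (le_lt_trans _ (hj j (leqnn j)))// sub0r normrN.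
exact: ler_norm.
Unshelve. all: by end_near. Qed.

Lemma sine_limit_cvg x : 0 <= x <= 1 ->
  sine_sum c n.+1 x @[n --> \oo] --> sine_limit x.
Proof.
move=> x01; have := @sine_sum_indic_cvg x.
rewrite indicE mem_set/= ?in_itv//= mulr1n.
by under eq_fun do rewrite mulr1.
Qed.

End DyadicBlocks.

(** * Continuous representatives of square-integrable classes *)

Section Lebesgue01.
Context {R : realType}.

Lemma lebesgue01_itv (a b : R) : 0 <= a -> a <= b -> b <= 1 ->
  lebesgue01 `]a, b[%classic = (b - a)%:E.
Proof.
move=> a0 ab b1; rewrite /lebesgue01/= /mrestr setIidl; last first.
  move=> x /=; rewrite !in_itv/= => /andP[ax xb].
  by rewrite (le_lt_trans a0 ax) (lt_le_trans xb b1).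
rewrite lebesgue_measure_itv/= lte_fin; case: ltP => // ba.
by have -> : b = a; [apply/le_anti; rewrite ba ab|rewrite subrr].
Qed.

Lemma lebesgue01_setT : lebesgue01 [set: R] = 1%E.
Proof.
by rewrite /lebesgue01/= /mrestr setTI lebesgue_measure_itv/= lte01 oppr0 adde0.
Qed.

Lemma integral_lebesgue01_le (f : R -> R) (M : R) :
  measurable_fun [set: R] f -> (forall x, 0 <= f x) -> 0 <= M ->
  (forall x, 0 <= x <= 1 -> f x <= M) ->
  (\int[lebesgue01]_x (f x)%:E <= M%:E)%E.
Proof.
move=> mf f0 M0 fM.
apply: (@le_trans _ _ (\int[lebesgue01]_(x in [set: R]) (cst M%:E) x)%E).
  apply: ae_ge0_le_integral => //.
  - by move=> x _; rewrite lee_fin.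
  - exact/measurable_EFinP.
  - exists (~` `]0, 1[%classic); split.
    + exact: measurableC.
    + by rewrite /lebesgue01/= /mrestr setICl measure0.
    + move=> x /= h x01; apply: h => _; rewrite lee_fin fM//.
      by move: x01; rewrite in_itv/= => /andP[/ltW -> /ltW ->].
by rewrite integral_cst//= lebesgue01_setT mule1.
Qed.

Lemma integral_lebesgue01_ge (f : R -> R) (e a b : R) :
  measurable_fun [set: R] f -> (forall x, 0 <= f x) -> 0 <= e ->
  0 <= a -> a <= b -> b <= 1 ->
  (forall x, a < x < b -> e <= f x) ->
  ((e * (b - a))%:E <= \int[lebesgue01]_x (f x)%:E)%E.
Proof.
move=> mf f0 e0 a0 ab b1 fe.
rewrite EFinM -(lebesgue01_itv a0 ab b1).
have mab : measurable (`]a, b[%classic : set (measurableTypeR R)).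
  exact: measurable_itv.
have := integral_indic lebesgue01 measurableT mab.
rewrite setIT => <-.
rewrite -ge0_integralZl//; last first.
  exact/measurable_EFinP.
apply: ge0_le_integral => //.
- by move=> x _; rewrite mule_ge0 ?lee_fin.
- by apply: emeasurable_funM => //; exact/measurable_EFinP.
- by apply/measurable_EFinP.
move=> x _; rewrite -EFinM lee_fin indicE.
case: (boolP (x \in _)) => [|_]; last by rewrite mulr0.
by rewrite inE/= in_itv/= mulr1 => /fe.
Qed.

End Lebesgue01.

Section ContinuousRepresentative.
Context {R : realType}.
Implicit Types (c : nat -> R) (x : R -> R).

Lemma L2_series_sine_sum c x : L2_series c x =
  (x \in Lfun lebesgue01 2%:E /\
   ('N[lebesgue01]_2%:E[EFin \o (fun xi : R => x xi - sine_sum c n.+1 xi)%R]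
       @[n --> \oo] --> 0)%E).
Proof. by []. Qed.

Lemma measurable_sine_sum c n : measurable_fun [set: R] (sine_sum c n).
Proof. by apply: continuous_measurable_fun; exact: continuous_sine_sum. Qed.

(** A continuous function exceeding [K] at a point exceeds it by a fixed amount on an
interval, so it stays at positive [L^2]-distance from functions bounded by [K].
Hence the bound holds whichever continuous representative is chosen. *)
Lemma L2_series_bound c x (K : R) :
  (forall n xi, 0 <= xi <= 1 -> `|sine_sum c n.+1 xi| <= K) ->
  L2_series c x -> E_space x -> forall xi, 0 <= xi <= 1 -> `|x xi| <= K.
Proof.
move=> cK; rewrite L2_series_sine_sum => -[xL xcvg] cx xi /andP[xi0 xi1].
have K0 : 0 <= K by rewrite (le_trans _ (cK 0%N 0 _))// lexx ler01.
have mx : measurable_fun [set: R] x.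
  move: xL; rewrite inE => /andP[mx _]; rewrite inE/= in mx; exact: mx.
rewrite leNgt; apply/negP => Kx.
pose e := (`|x xi| - K) / 2.
have e0 : 0 < e by rewrite divr_gt0// subr_gt0.
have xiI : `[0, 1]%classic xi by rewrite /= in_itv/= xi0 xi1.
have /subspace_continuousP/(_ xi xiI)/cvgrPdist_lt/(_ e e0) := cx.
rewrite near_withinE => /nbhs_ballP[r /= r0 hr].
pose a := Num.max 0 (xi - r); pose b := Num.min 1 (xi + r).
have a0 : 0 <= a by rewrite le_max lexx.
have b1 : b <= 1 by rewrite ge_min lexx.
have ab : a < b.
  rewrite lt_min !gt_max ltr01/=; apply/andP; split; lra.
have xge s : a < s < b -> K + e <= `|x s|.
  rewrite gt_max lt_min => /andP[/andP[s0 rs] /andP[s1 sr]].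
  have := hr s; rewrite /ball/= in_itv/= (ltW s0) (ltW s1) => h.
  have {h} : `|x xi - x s| < e by apply: h => //; rewrite ltr_norml; lra.
  have := ler_normD (x s) (x xi - x s).
  by rewrite addrC subrK /e; lra.
have bd n : (((e ^+ 2 * (b - a)) `^ 2^-1)%R%:E <=
    'N[lebesgue01]_2%:E[EFin \o (fun s : R => x s - sine_sum c n.+1 s)%R])%E.
  rewrite Lnorm2_sqrt -poweR_EFin.
  have mxs : measurable_fun [set: R] (fun s => (x s - sine_sum c n.+1 s) ^+ 2).
    by apply: measurable_funX; apply: measurable_funB => //;
      exact: measurable_sine_sum.
  rewrite gt0_ler_poweR//.
  - by rewrite in_itv/= leey lee_fin mulr_ge0 ?sqr_ge0// subr_ge0 ltW.
  - by rewrite in_itv/= leey integral_ge0// => s _; rewrite lee_fin sqr_ge0.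
  - apply: integral_lebesgue01_ge => //.
    + by move=> s; rewrite sqr_ge0.
    + by rewrite sqr_ge0.
    + exact: ltW.
    + move=> s sab; rewrite -[leRHS]real_normK ?num_real//.
      rewrite lerXn2r ?nnegrE ?(ltW e0)//.
      have s01 : 0 <= s <= 1.
        move: sab => /andP[as_ sb].
        by rewrite (le_trans a0 (ltW as_)) (le_trans (ltW sb) b1).
      have h1 := xge s sab; have h2 := cK n s s01.
      have := ler_normD (x s - sine_sum c n.+1 s) (sine_sum c n.+1 s).
      by rewrite subrK; lra.
have ab0 : 0 < (e ^+ 2 * (b - a)) `^ 2^-1.
  by rewrite powR_gt0// mulr_gt0 ?subr_gt0// exprn_gt0.
have : (((e ^+ 2 * (b - a)) `^ 2^-1)%R%:E <= 0)%E.
  rewrite -(cvg_lim _ xcvg)//; apply: lime_ge; first by apply: cvgP xcvg.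
  exact: nearW.
by rewrite lee_fin leNgt ab0.
Qed.

Variables (c : nat -> R) (y q : R).
Hypothesis y0 : 0 <= y.
Hypothesis q12 : 2^-1 <= q < 1.
Hypothesis block_grid : forall j N g : nat, (N <= 2 ^ j)%N -> (g <= 16 ^ j)%N ->
  `|\sum_(2 ^ j <= k < 2 ^ j + N) c k * eigfun k (g%:R / 16 ^+ j)| <= y * q ^+ j.
Hypothesis coef_growth : forall j k : nat, (2 ^ j <= k < 2 ^ j.+1)%N ->
  `|c k| <= 2 ^+ j * y.

Let tail0 j : 0 <= tail_bound y q j.
Proof.
have h := @sine_sum_dyadic_dist _ c y q y0 q12 block_grid coef_growth j (2 ^ j) 0.
by apply: le_trans (h _ _) => //; rewrite lexx ler01.
Qed.

Let sle n xi : 0 <= xi <= 1 -> `|sine_sum c n.+1 xi| <= tail_bound y q 0.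
Proof. by move=> xi01; apply: (sine_sum_le y0 q12 block_grid). Qed.

Let scvg := sine_limit_cvg y0 q12 block_grid coef_growth.

Lemma sine_limit_dist j n xi : 0 <= xi <= 1 -> (2 ^ j <= n)%N ->
  `|sine_limit c xi - sine_sum c n xi| <= 2 * tail_bound y q j.
Proof.
move=> xi01 jn.
have h (u : R) : `|sine_sum c n xi - u| <= 2 * tail_bound y q j ->
  `|u - sine_sum c n xi| <= 2 * tail_bound y q j by rewrite distrC.
have cv : `|sine_sum c i.+1 xi - sine_sum c n xi| @[i --> \oo] -->
    `|sine_limit c xi - sine_sum c n xi|.
  apply: cvg_norm; apply: cvgB; last exact: cvg_cst.
  exact: scvg.
rewrite -(cvg_lim _ cv)//; apply: limr_le; first by apply: cvgP cv.
near=> i.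
have d := sine_sum_dyadic_dist y0 q12 block_grid coef_growth xi01.
rewrite -(subrKA (sine_sum c (2 ^ j) xi)) (le_trans (ler_normD _ _))//.
rewrite mulrDl mul1r lerD//.
  by apply: d; apply: leqW; near: i; exact: nbhs_infty_ge.
by rewrite distrC d.
Unshelve. all: by end_near. Qed.

Lemma E_space_sine_limit : E_space (sine_limit c).
Proof.
apply/subspace_continuousP => xi /=; rewrite in_itv/= => xi01.
apply/cvgrPdist_lt => e e0.
have e8 : 0 < e / 8 by rewrite divr_gt0.
have /cvgrPdist_lt/(_ _ e8)[j _ /(_ j (leqnn j))] := tail_bound_cvg0 y q12.
rewrite sub0r normrN (ger0_norm (tail0 j)) => tj.
have /cvgrPdist_lt/(_ _ e8) := @continuous_sine_sum R c (2 ^ j) xi.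
rewrite near_withinE; apply: filterS => z sz /=; rewrite in_itv/= => z01.
have h1 := sine_limit_dist xi01 (leqnn (2 ^ j)).
have h2 := sine_limit_dist z01 (leqnn (2 ^ j)).
rewrite -(subrKA (sine_sum c (2 ^ j) xi)) (le_lt_trans (ler_normD _ _))//.
have := ler_normD (sine_sum c (2 ^ j) xi - sine_sum c (2 ^ j) z)
   (sine_sum c (2 ^ j) z - sine_limit c z).
rewrite subrKA (distrC (sine_sum c (2 ^ j) z) (sine_limit c z)); lra.
Qed.

Lemma measurable_sine_limit : measurable_fun [set: R] (sine_limit c).
Proof.
apply: (@measurable_fun_cvg _ _ R [set: R]
  (fun n xi => sine_sum c n.+1 xi * \1_`[0, 1] xi)).
- by move=> n; apply: measurable_funM => //; exact: measurable_sine_sum.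
- move=> xi _; exact: (sine_sum_indic_cvg y0 q12 block_grid).
Qed.

Lemma L2_series_sine_limit : L2_series c (sine_limit c).
Proof.
rewrite L2_series_sine_sum.
have ms := measurable_sine_limit.
have sl xi : 0 <= xi <= 1 -> `|sine_limit c xi| <= tail_bound y q 0.
  move=> xi01.
  have cv : `|sine_sum c n.+1 xi| @[n --> \oo] --> `|sine_limit c xi|.
    by apply: cvg_norm; exact: scvg.
  rewrite -(cvg_lim _ cv)//; apply: limr_le; first by apply: cvgP cv.
  by apply: nearW => n; exact: sle.
split.
  apply: Lfun2_sqr_lty => //.
  apply: (@le_lt_trans _ _ (tail_bound y q 0 ^+ 2)%:E); last exact: ltry.
  apply: integral_lebesgue01_le.
  - exact: measurable_funX.
  - by move=> x; rewrite sqr_ge0.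
  - by rewrite sqr_ge0.
  - move=> x x01; rewrite -[leLHS]real_normK ?num_real//.
    by rewrite lerXn2r ?nnegrE// sl.
pose u n : R := 2 * tail_bound y q (trunc_log 2 n.+1).
apply: (@squeeze_cvge _ _ _ _ (cst 0%E) _ (EFin \o u)).
- apply: nearW => n; rewrite Lnorm_ge0/= Lnorm2_sqrt.
  have u0 : 0 <= u n by rewrite mulr_ge0.
  have -> : (u n)%:E = ((u n ^+ 2)%:E `^ 2^-1)%E.
    by rewrite poweR_EFin -(powR_mulrn 2)// -powRrM divff// powRr1.
  have mxs : measurable_fun [set: R]
      (fun s => (sine_limit c s - sine_sum c n.+1 s) ^+ 2).
    by apply: measurable_funX; apply: measurable_funB => //;
      exact: measurable_sine_sum.
  rewrite gt0_ler_poweR//.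
  - by rewrite in_itv/= leey integral_ge0// => s _; rewrite lee_fin sqr_ge0.
  - by rewrite in_itv/= leey lee_fin sqr_ge0.
  - apply: integral_lebesgue01_le => //.
    + by move=> s; rewrite sqr_ge0.
    + by rewrite sqr_ge0.
    + move=> s s01; rewrite -[leLHS]real_normK ?num_real//.
      by rewrite lerXn2r ?nnegrE// sine_limit_dist// trunc_logP.
- exact: cvg_cst.
- apply: cvg_EFin; first by near=> n.
  rewrite (_ : 0 = 2 * 0 :> R); last by rewrite mulr0.
  apply: cvgMl_tmp.
  apply: (cvg_comp (fun n => trunc_log 2 n.+1) (tail_bound y q) _
    (tail_bound_cvg0 y q12)).
  move=> A [j _ jA]; exists (2 ^ j)%N => // n /= jn.
  by apply: jA => /=; rewrite trunc_log_max// leqW.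
Unshelve. all: by end_near. Qed.

Lemma class_in_E_L2_series : class_in_E (L2_series c).
Proof.
exists (sine_limit c); split; first exact: L2_series_sine_limit.
exact: E_space_sine_limit.
Qed.

Lemma class_E_norm_L2_series : 0 <= class_E_norm (L2_series c) <= tail_bound y q 0.
Proof.
rewrite /class_E_norm; set x := xget _ _.
have [xL xE] : (L2_series c `&` E_space) x.
  by apply: xgetPex; exact: class_in_E_L2_series.
have bx := L2_series_bound sle xL xE.
have ub : ubound [set `|x xi| | xi in `[0, 1]%classic] (tail_bound y q 0).
  by move=> _ [xi/= /[!in_itv]/= xi01 <-]; exact: bx.
have x0 : [set `|x xi| | xi in `[0, 1]%classic] `|x 0|.
  by exists 0 => //=; rewrite in_itv/= lexx ler01.
rewrite /E_norm; apply/andP; split.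
  apply: (le_trans (normr_ge0 (x 0))); apply: ub_le_sup => //.
  by exists (tail_bound y q 0).
by apply: ge_sup => //; exists `|x 0|.
Qed.

End ContinuousRepresentative.

(** * The energy of the random coefficients *)

(** The integral of a nonnegative function is a supremum over the simple functions
below it, hence monotone even where measurability is unknown, as is the case for
the norm of a chosen representative. *)
Lemma ge0_le_integral_nonmeasurable (R : realType) (d : measure_display)
    (T : measurableType d) (mu : {measure set T -> \bar R}) (f g : T -> \bar R) :
  (forall x, 0 <= f x)%E -> (forall x, f x <= g x)%E ->
  (\int[mu]_x f x <= \int[mu]_x g x)%E.
Proof.
move=> f0 fg; have g0 x : (0 <= g x)%E by exact: le_trans (f0 x) (fg x).
rewrite !ge0_integralTE//; apply: ge_ereal_sup => _ [h hf <-].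
apply: ereal_sup_ubound.
by exists h => //= x; exact: le_trans (hf x) (fg x).
Qed.

Section Energy.
Context {R : realType} {d : measure_display} {T : measurableType d}
  (P : probability T R).
Variables (Z : nat -> T -> R) (q : R) (m : nat).
Hypothesis m0 : (0 < m)%N.
Hypothesis q12 : 2^-1 <= q < 1.
Hypothesis qm : 32 * q ^+ (2 * m) <= 2^-1.

Let q0 : 0 < q.
Proof. by case/andP: q12 => h _; rewrite (lt_le_trans _ h)// invr_gt0. Qed.

Definition block_sum j N (xi : R) (w : T) : R :=
  \sum_(2 ^ j <= k < 2 ^ j + N) Z k w * eigfun k xi.

Hypothesis block_subg : forall j N xi, (N <= 2 ^ j)%N ->
  subgaussian P (block_sum j N xi) ((5 * q ^+ (2 * j)) ^+ 2).
Hypothesis Z_subg : forall k, (0 < k)%N -> subgaussian P (Z k) (5 ^+ 2).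

(** The first weight is what makes a bound of the energy yield the rate [q ^ j] for
block sums; the second one allows the coefficients to grow with the block, which is
harmless since they only serve to pass from the grid to the interval. *)
Definition block_energy j w : R :=
  q^-1 ^+ (2 * m * j) * (\sum_(i < (2 ^ j).+1) \sum_(g < (16 ^ j).+1)
    block_sum j i (g%:R / 16 ^+ j) w ^+ (2 * m)) +
  2^-1 ^+ (2 * m * j) * \sum_(2 ^ j <= k < 2 ^ j.+1) Z k w ^+ (2 * m).

Definition energy w : \bar R := (\sum_(j <oo) (block_energy j w)%:E)%E.

Let even_ge0 (x : R) : 0 <= x ^+ (2 * m).
Proof. by rewrite exprM exprn_ge0 ?sqr_ge0. Qed.

Lemma block_energy_ge0 j w : 0 <= block_energy j w.
Proof.
rewrite addr_ge0// mulr_ge0 ?exprn_ge0 ?invr_ge0 ?(ltW q0)//.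
  by apply: sumr_ge0 => i _; apply: sumr_ge0.
exact: sumr_ge0.
Qed.

Let mblock j N xi : (N <= 2 ^ j)%N -> measurable_fun [set: T] (block_sum j N xi).
Proof. by move=> Nj; case: (block_subg xi Nj). Qed.

Let mZ k : (0 < k)%N -> measurable_fun [set: T] (Z k).
Proof. by move=> k0; case: (Z_subg k0). Qed.

Let mgrid j : measurable_fun [set: T] (fun w =>
  \sum_(i < (2 ^ j).+1) \sum_(g < (16 ^ j).+1)
    block_sum j i (g%:R / 16 ^+ j) w ^+ (2 * m)).
Proof.
apply: measurable_sum => i; apply: measurable_sum => g; apply: measurable_funX.
by apply: mblock; rewrite -ltnS.
Qed.

Let mcoef j : measurable_fun [set: T] (fun w =>
  \sum_(2 ^ j <= k < 2 ^ j.+1) Z k w ^+ (2 * m)).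
Proof.
under eq_fun do rewrite -{1}(add0n (2 ^ j)%N) big_addn big_mkord.
apply: measurable_sum => i; apply: measurable_funX; apply: mZ.
by rewrite addn_gt0 expn_gt0 orbT.
Qed.

Lemma measurable_block_energy j : measurable_fun [set: T] (block_energy j).
Proof.
by apply: measurable_funD; apply: measurable_funM.
Qed.

Definition energy_const : R := 5 * (gaussian_moment_bound m * 5 ^+ (2 * m)).

Let moment_ge0 : 0 <= @gaussian_moment_bound R m.
Proof. by rewrite !mulr_ge0// expR_ge0. Qed.

Let C0 : 0 <= @gaussian_moment_bound R m * 5 ^+ (2 * m).
Proof. by rewrite mulr_ge0// exprn_ge0. Qed.

Lemma energy_const_ge0 : 0 <= energy_const. Proof. by rewrite mulr_ge0. Qed.

(** There are at most [4 * 32 ^ j] partial sums and grid points, and each weighted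
moment is of order [q ^ (2 * m * j)]. *)
Lemma integral_block_energy_le j :
  (\int[P]_w (block_energy j w)%:E <= (energy_const * 2^-1 ^+ j)%:E)%E.
Proof.
pose K : R := gaussian_moment_bound m * 5 ^+ (2 * m).
have EQ (i : 'I_(2 ^ j).+1) (xi : R) :
    (\int[P]_w (block_sum j i xi w ^+ (2 * m))%:E <=
     (K * q ^+ (2 * j) ^+ (2 * m))%:E)%E.
  rewrite /K -mulrA -exprMn.
  apply: subgaussian_moment => //; first by rewrite mulr_gt0// exprn_gt0.
  by apply: block_subg; rewrite -ltnS.
have EZ k : (0 < k)%N -> (\int[P]_w (Z k w ^+ (2 * m))%:E <= K%:E)%E.
  by move=> k0; apply: subgaussian_moment => //; exact: Z_subg.
have qi : 0 <= q^-1 ^+ (2 * m * j) by rewrite exprn_ge0// invr_ge0 ltW.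
have hi : 0 <= 2^-1 ^+ (2 * m * j) :> R by rewrite exprn_ge0.
have sumg0 w : 0 <= \sum_(i < (2 ^ j).+1) \sum_(g < (16 ^ j).+1)
    block_sum j i (g%:R / 16 ^+ j) w ^+ (2 * m).
  by apply: sumr_ge0 => i _; apply: sumr_ge0.
have sumz0 w : 0 <= \sum_(2 ^ j <= k < 2 ^ j.+1) Z k w ^+ (2 * m).
  exact: sumr_ge0.
rewrite /block_energy; under eq_integral do rewrite EFinD.
rewrite ge0_integralD//; last 4 first.
- by move=> w _; rewrite lee_fin mulr_ge0.
- by apply/measurable_EFinP; exact: measurable_funM.
- by move=> w _; rewrite lee_fin mulr_ge0.
- by apply/measurable_EFinP; exact: measurable_funM.
under eq_integral do rewrite EFinM.
rewrite ge0_integralZl//; last 2 first.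
- by apply/measurable_EFinP.
- by move=> w _; rewrite lee_fin.
under [X in (_ + X <= _)%E]eq_integral do rewrite EFinM.
rewrite ge0_integralZl//; last 2 first.
- by apply/measurable_EFinP.
- by move=> w _; rewrite lee_fin.
have h1 : (\int[P]_w (\sum_(i < (2 ^ j).+1) \sum_(g < (16 ^ j).+1)
    block_sum j i (g%:R / 16 ^+ j) w ^+ (2 * m))%:E <=
    (2 * 2 ^+ j * (2 * 16 ^+ j) * (K * q ^+ (2 * j) ^+ (2 * m)))%:E)%E.
  under eq_integral => w _.
    rewrite -sumEFin; under eq_bigr do rewrite -sumEFin; over.
  rewrite ge0_integral_sum//; last 2 first.
  - move=> i; apply: emeasurable_sum => g; apply/measurable_EFinP.
    by apply: measurable_funX; apply: mblock; rewrite -ltnS.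
  - by move=> i w _; apply: sume_ge0 => g _; rewrite lee_fin.
  apply: (@le_trans _ _ (\sum_(i < (2 ^ j).+1) \sum_(g < (16 ^ j).+1)
      (K * q ^+ (2 * j) ^+ (2 * m))%:E)%E).
    apply: lee_sum => i _; rewrite ge0_integral_sum//.
    - by apply: lee_sum => g _; exact: EQ.
    - move=> g; apply/measurable_EFinP.
      by apply: measurable_funX; apply: mblock; rewrite -ltnS.
    - by move=> g w _; rewrite lee_fin.
  under eq_bigr do rewrite sumEFin.
  rewrite sumEFin lee_fin !sumr_const !card_ord -!mulrnA -[leLHS]mulr_natl.
  rewrite ler_wpM2r ?mulr_ge0 ?exprn_ge0 ?(ltW q0)//.
  rewrite natrM mulrC ler_pM// -natrX -natrM ler_nat mul2n -addnn -addn1.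
    by rewrite leq_add2l expn_gt0.
  by rewrite leq_add2l expn_gt0.
have h2 : (\int[P]_w (\sum_(2 ^ j <= k < 2 ^ j.+1) Z k w ^+ (2 * m))%:E <=
    (2 ^+ j * K)%:E)%E.
  under eq_integral => w _.
    rewrite -{1}(add0n (2 ^ j)%N) big_addn big_mkord -sumEFin; over.
  have -> : (2 ^ j.+1 - 2 ^ j = 2 ^ j)%N by rewrite expnS mul2n -addnn addnK.
  have k0 i : (0 < i + 2 ^ j)%N by rewrite addn_gt0 expn_gt0 orbT.
  rewrite ge0_integral_sum//; last 2 first.
  - by move=> i; apply/measurable_EFinP; apply: measurable_funX; exact: mZ.
  - by move=> i w _; rewrite lee_fin.
  apply: (@le_trans _ _ (\sum_(i < 2 ^ j) K%:E)%E).
    by apply: lee_sum => i _; exact: EZ.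
  by rewrite sumEFin lee_fin sumr_const card_ord -[leLHS]mulr_natl natrX.
apply: (le_trans (leeD (lee_wpmul2l _ h1) (lee_wpmul2l _ h2))).
- by rewrite lee_fin.
- by rewrite lee_fin.
rewrite -!EFinM -EFinD lee_fin /energy_const -/K.
have -> : q^-1 ^+ (2 * m * j) *
    (2 * 2 ^+ j * (2 * 16 ^+ j) * (K * q ^+ (2 * j) ^+ (2 * m))) =
    4 * K * (32 * q ^+ (2 * m)) ^+ j.
  have -> : q ^+ (2 * j) ^+ (2 * m) = q ^+ (2 * m * j) * q ^+ (2 * m * j).
    by rewrite -exprM -exprD; congr (_ ^+ _); lia.
  have -> : (32 * q ^+ (2 * m)) ^+ j = 2 ^+ j * 16 ^+ j * q ^+ (2 * m * j).
    rewrite exprMn -exprM; congr (_ * _); rewrite -exprMn; congr (_ ^+ _); lra.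
  rewrite exprVn; field.
  by rewrite expf_neq0// gt_eqF.
have -> : 2^-1 ^+ (2 * m * j) * (2 ^+ j * K) = K * (2^-1 ^+ (2 * m) * 2) ^+ j.
  by rewrite exprMn -exprM; ring.
have -> : 5 * K * 2^-1 ^+ j = 4 * K * 2^-1 ^+ j + K * 2^-1 ^+ j by ring.
apply: lerD; apply: ler_wpM2l; rewrite ?mulr_ge0//.
  by rewrite lerXn2r ?nnegrE ?invr_ge0// mulr_ge0// exprn_ge0// ltW.
rewrite lerXn2r ?nnegrE ?invr_ge0 ?mulr_ge0 ?exprn_ge0//.
rewrite -ler_pdivlMr// -expr2 ler_wiXn2l ?invr_ge0 ?invf_le1//; first lra.
by lia.
Qed.

Lemma integral_energy_le : (\int[P]_w energy w <= (energy_const * 2)%:E)%E.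
Proof.
rewrite /energy integral_nneseries//; last 2 first.
- by move=> j; apply/measurable_EFinP; exact: measurable_block_energy.
- by move=> j w _; rewrite lee_fin block_energy_ge0.
apply: lime_le.
  apply: is_cvg_nneseries => j _ _; apply: integral_ge0 => w _.
  by rewrite lee_fin block_energy_ge0.
apply: nearW => n.
apply: (@le_trans _ _ (\sum_(0 <= j < n) (energy_const * 2^-1 ^+ j)%:E)%E).
  by apply: lee_sum => j _; exact: integral_block_energy_le.
rewrite sumEFin lee_fin -mulr_sumr ler_wpM2l ?energy_const_ge0//.
suff -> : \sum_(0 <= j < n) 2^-1 ^+ j = 2 - 2 * 2^-1 ^+ n :> R.
  by rewrite gerBl mulr_ge0// exprn_ge0.
elim: n => [|n IH]; first by rewrite big_nil expr0; ring.
by rewrite big_nat_recr//= IH exprS; field.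
Qed.

Lemma measurable_energy : measurable_fun [set: T] energy.
Proof.
apply: (@ge0_emeasurable_sum _ _ _ setT (fun j w => (block_energy j w)%:E) xpredT).
- by move=> j w _ _; rewrite lee_fin block_energy_ge0.
- by move=> j _; apply/measurable_EFinP; exact: measurable_block_energy.
Qed.

Lemma block_energy_le j w u : energy w = u%:E -> block_energy j w <= u.
Proof.
move=> wu; rewrite -lee_fin -wu /energy.
have h := @nneseries_lim_ge R (fun j => (block_energy j w)%:E) xpredT 0 j.+1.
apply: le_trans (h _); last by move=> n _ _; rewrite lee_fin block_energy_ge0.
rewrite big_nat_recr//= leeDr// sume_ge0// => i _.
by rewrite lee_fin block_energy_ge0.
Qed.

Lemma energy_block_grid (y : R) w : 0 <= y -> energy w = (y ^+ (2 * m))%:E ->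
  forall j N g : nat, (N <= 2 ^ j)%N -> (g <= 16 ^ j)%N ->
  `|\sum_(2 ^ j <= k < 2 ^ j + N) Z k w * eigfun k (g%:R / 16 ^+ j)| <= y * q ^+ j.
Proof.
move=> y0 wy j N g Nj gj.
have := block_energy_le j wy => h.
have h1 : q^-1 ^+ (2 * m * j) * block_sum j N (g%:R / 16 ^+ j) w ^+ (2 * m) <=
    y ^+ (2 * m).
  apply: le_trans h; rewrite /block_energy -[leLHS]addr0 lerD//; last first.
    by rewrite mulr_ge0 ?exprn_ge0// sumr_ge0.
  rewrite ler_wpM2l ?exprn_ge0 ?invr_ge0 ?(ltW q0)//.
  rewrite -ltnS in Nj; rewrite -ltnS in gj.
  rewrite (bigD1 (Ordinal Nj))//= (bigD1 (Ordinal gj))//= -addrA lerDl.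
  rewrite addr_ge0 ?sumr_ge0// => i _; exact: sumr_ge0.
rewrite -/(block_sum j N (g%:R / 16 ^+ j) w).
rewrite -ler_pdivrMr ?exprn_gt0// -(ler_pXn2r (_ : 0 < 2 * m)%N) ?muln_gt0//.
- apply: le_trans h1; rewrite expr_div_n -exprM -normrX (ger0_norm (even_ge0 _)).
  by rewrite exprVn mulrC mulnC.
- by rewrite nnegrE divr_ge0 ?exprn_ge0// ltW.
Qed.

Lemma energy_coef_growth (y : R) w : 0 <= y -> energy w = (y ^+ (2 * m))%:E ->
  forall j k : nat, (2 ^ j <= k < 2 ^ j.+1)%N -> `|Z k w| <= 2 ^+ j * y.
Proof.
move=> y0 wy j k /andP[k1 k2].
have h := block_energy_le j wy.
have h1 : 2^-1 ^+ (2 * m * j) * Z k w ^+ (2 * m) <= y ^+ (2 * m).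
  apply: le_trans h; rewrite /block_energy -[leLHS]add0r lerD//.
    rewrite mulr_ge0 ?exprn_ge0 ?invr_ge0 ?(ltW q0)//.
    by apply: sumr_ge0 => i _; exact: sumr_ge0.
  rewrite ler_wpM2l ?exprn_ge0//.
  rewrite (bigD1_seq k) ?mem_index_iota ?k1 ?k2 ?iota_uniq//=.
  by rewrite lerDl sumr_ge0.
rewrite mulrC -ler_pdivrMr ?exprn_gt0// -(ler_pXn2r (_ : 0 < 2 * m)%N) ?muln_gt0//.
- apply: le_trans h1; rewrite expr_div_n -exprM -normrX (ger0_norm (even_ge0 _)).
  by rewrite exprVn mulrC mulnC.
- by rewrite nnegrE divr_ge0 ?exprn_ge0.
Qed.

End Energy.

(** * The fractional Ornstein-Uhlenbeck process *)

Section EigenvalueBounds.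
Context {R : realType}.

Lemma sqr_le_eigval (k : nat) : k%:R ^+ 2 <= eigval k :> R.
Proof.
rewrite /eigval ler_peMr ?sqr_ge0// -[leLHS](expr1n _ 2).
rewrite lerXn2r ?nnegrE ?pi_ge0//.
by apply: le_trans (pi_ge2 R); lra.
Qed.

Lemma eigval_gt0 (k : nat) : (0 < k)%N -> 0 < eigval k :> R.
Proof.
by move=> k0; apply: lt_le_trans (sqr_le_eigval k); rewrite exprn_gt0// ltr0n.
Qed.

Lemma powRN_anti (H a b : R) : 0 <= H -> 0 < a -> a <= b -> b `^ (- H) <= a `^ (- H).
Proof.
move=> H0 a0 ab; rewrite !powRN lef_pV2 ?posrE ?powR_gt0//; last exact: lt_le_trans ab.
by apply: ge0_ler_powR => //; rewrite nnegrE ltW// (lt_le_trans a0).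
Qed.

(** The variance count of a dyadic block: [2 ^ j] terms, each with
[eigval k >= 4 ^ j]. *)
Lemma dyadic_eigval_powR (H : R) (j k : nat) : 0 <= H -> (2 ^ j <= k)%N ->
  2 ^+ j * (eigval k `^ (- H)) ^+ 2 <= (2 `^ (1 - 4 * H)) ^+ j.
Proof.
move=> H0 jk.
have e4 : 4 ^+ j <= eigval k :> R.
  apply: le_trans (sqr_le_eigval k).
  have -> : 4 ^+ j = (2 ^+ j) ^+ 2 :> R.
    by rewrite exprAC; congr (_ ^+ _); rewrite expr2; lra.
  by rewrite lerXn2r ?nnegrE ?exprn_ge0// -natrX ler_nat.
apply: (@le_trans _ _ (2 ^+ j * ((4 ^+ j) `^ (- H)) ^+ 2)).
  rewrite ler_wpM2l ?exprn_ge0// lerXn2r ?nnegrE ?powR_ge0//.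
  by apply: powRN_anti => //; rewrite exprn_gt0.
have -> : 4 ^+ j = 2 `^ (2 * j%:R) :> R.
  by rewrite powRrM (powR_mulrn 2)// powR_mulrn ?exprn_ge0//; congr (_ ^+ _);
    rewrite expr2; lra.
rewrite -powRrM -(powR_mulrn 2) ?powR_ge0// -powRrM.
rewrite -[X in X * _ <= _]powR_mulrn// -[leRHS]powR_mulrn ?powR_ge0//.
rewrite -[leRHS]powRrM.
rewrite -powRD; last by rewrite pnatr_eq0 implybT.
by rewrite le_eqVlt; apply/orP; left; apply/eqP; congr (_ `^ _); ring.
Qed.

(** The condition [4^-1 < H] enters here: the variances of the dyadic blocks decay
geometrically. *)
Lemma dyadic_rate (H : R) : 4^-1 < H ->
  exists2 q : R, 2^-1 <= q < 1 & 2 `^ (1 - 4 * H) <= q ^+ 4.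
Proof.
move=> H4; pose z : R := 2 `^ ((1 - 4 * H) / 4).
exists (Num.max 2^-1 z).
  rewrite le_max lexx/= gt_max invf_lt1 ?ltr1n//=.
  rewrite /z (_ : _ / 4 = - ((4 * H - 1) / 4)); last by field.
  rewrite powRN invf_lt1 ?powR_gt0//.
  have y0 : 0 < (4 * H - 1) / 4 by rewrite divr_gt0// subr_gt0; lra.
  have := @gt0_ltr_powR R _ y0 1 2; rewrite powR1.
  by apply; rewrite ?nnegrE ?ltr1n.
have -> : 2 `^ (1 - 4 * H) = z ^+ 4.
  by rewrite /z -(powR_mulrn 4) ?powR_ge0// -powRrM divfK.
rewrite lerXn2r ?nnegrE ?powR_ge0// ?le_max ?lexx ?orbT//.
by rewrite powR_ge0 orbT.
Qed.

Lemma expn_small (q e : R) (p : nat) : 0 <= q < 1 -> 0 < e ->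
  exists2 m : nat, (p <= m)%N & q ^+ (2 * m) <= e.
Proof.
move=> /andP[q0 q1] e0.
have /cvgrPdist_le/(_ e e0)[N _ hN] : q ^+ n @[n --> \oo] --> 0.
  by apply: cvg_expr; rewrite ger0_norm.
exists (maxn p N); first exact: leq_maxl.
have := hN (2 * maxn p N)%N; rewrite /= sub0r normrN ger0_norm ?exprn_ge0//.
by apply; lia.
Qed.

End EigenvalueBounds.

Section FractionalOrnsteinUhlenbeck.
Context {R : realType} {d : measure_display} {T : measurableType d}
  {P : probability T R}.
Variables (H : R) (beta : nat -> R -> {RV P >-> R}) (t : R).
Hypothesis H01 : 0 < H < 1.
Hypothesis hbeta : forall k : nat, (1 <= k)%N ->
  fractional_brownian_motion H (beta k).
Hypothesis hindep : independent_processes [set k : nat | (1 <= k)%N] beta.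
Hypothesis t0 : 0 <= t.

Let Z k w := fou_coef beta t w k.

Lemma fou_coef_subgaussian k : (0 < k)%N ->
  subgaussian P (Z k) ((3 * eigval k `^ (- H)) ^+ 2).
Proof.
move=> k0; apply: (path_integral_subgaussian H01 (hbeta k0)) => //.
exact: eigval_gt0.
Qed.

Lemma fou_coef_subgaussian_cst k : (0 < k)%N -> subgaussian P (Z k) (5 ^+ 2).
Proof.
move=> k0; apply: subgaussian_le (fou_coef_subgaussian k0).
case/andP: H01 => H0 _.
have := @dyadic_eigval_powR R H 0 k (ltW H0) k0.
rewrite !expr0 mul1r exprMn => h.
apply: (@le_trans _ _ (3 ^+ 2 * 1)); first by rewrite ler_wpM2l// sqr_ge0.
by rewrite mulr1 lerXn2r ?nnegrE//; lra.
Qed.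

Lemma fou_block_subgaussian (q : R) : 0 <= q -> 2 `^ (1 - 4 * H) <= q ^+ 4 ->
  forall j N xi, (N <= 2 ^ j)%N ->
  subgaussian P (block_sum Z j N xi) ((5 * q ^+ (2 * j)) ^+ 2).
Proof.
move=> q0 hq j N xi Nj; case/andP: (H01) => H0 _.
have kpos k : k \in index_iota (2 ^ j) (2 ^ j + N) -> (0 < k)%N.
  rewrite mem_index_iota => /andP[h _].
  by apply: leq_trans h; rewrite expn_gt0.
have := @subgaussian_indep_sum R d T P [set k : nat | (1 <= k)%N]
  (fun k => process_sigma (beta k)) Z (fun k => (3 * eigval k `^ (- H)) ^+ 2)
  (fun k => eigfun k xi) (index_iota (2 ^ j) (2 ^ j + N)).
have -> : block_sum Z j N xi =
    fun w => \sum_(k <- index_iota (2 ^ j) (2 ^ j + N)) eigfun k xi * Z k w.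
  by apply/funext => w; apply: eq_bigr => k _; rewrite mulrC.
move=> h; apply: subgaussian_le (h _ _ _ _ _ _) => {h}.
- apply: (@le_trans _ _ (\sum_(2 ^ j <= k < 2 ^ j + N)
      18 * (q ^+ 4) ^+ j / 2 ^+ j)).
    apply: ler_sum_nat => k /andP[jk _].
    rewrite ler_pdivlMr ?exprn_gt0//.
    have hk := @dyadic_eigval_powR R H j k (ltW H0) jk.
    have hq' : (2 `^ (1 - 4 * H)) ^+ j <= (q ^+ 4) ^+ j.
      by rewrite lerXn2r ?nnegrE ?powR_ge0 ?exprn_ge0.
    have -> : eigfun k xi ^+ 2 * (3 * eigval k `^ (- H)) ^+ 2 * 2 ^+ j =
      (eigfun k xi ^+ 2 * 9) * (2 ^+ j * (eigval k `^ (- H)) ^+ 2) by ring.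
    apply: ler_pM.
    - by apply: mulr_ge0 => //; exact: sqr_ge0.
    - by apply: mulr_ge0; [rewrite exprn_ge0|exact: sqr_ge0].
    - rewrite [leRHS](_ : _ = 2 * 9); last by ring.
      by rewrite ler_wpM2r// sqr_eigfun_le2.
    - exact: le_trans hk hq'.
  rewrite sumr_const_nat addKn -[leLHS]mulr_natl.
  apply: (@le_trans _ _ (2 ^+ j * (18 * (q ^+ 4) ^+ j / 2 ^+ j))).
    rewrite ler_wpM2r//; last by rewrite -natrX ler_nat.
    by rewrite divr_ge0 ?mulr_ge0 ?exprn_ge0.
  have -> : (q ^+ 4) ^+ j = (q ^+ (2 * j)) ^+ 2.
    by rewrite -!exprM; congr (_ ^+ _); lia.
  rewrite mulrC divfK ?expf_neq0// exprMn ler_wpM2r ?sqr_ge0//; lra.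
- by move=> k A; exact: process_sigma_measurable.
- exact: hindep.
- move=> k B /= k1 mB; apply: path_integral_process_sigma => //.
    exact/ltW/eigval_gt0.
  by case: (hbeta k1).
- by move=> k /= k1; exact: fou_coef_subgaussian.
- exact: iota_uniq.
- by move=> k /kpos.
Qed.

(** The factor between the [2 * m]-th root of the energy and the sup norm, read off
from [tail_bound] at the index 0. *)
Definition sup_const (q : R) : R := 2 * block_const / (1 - q).

Lemma fou_energy_bound (q : R) (m p : nat) (w : T) (u : R) :
  (0 < m)%N -> (p <= m)%N -> 2^-1 <= q < 1 -> energy Z q m w = u%:E ->
  class_in_E (fou beta t w) /\
  class_E_norm (fou beta t w) ^+ (2 * p) <= 1 + sup_const q ^+ (2 * m) * u.
Proof.
move=> m0 pm q12 wu.
have q0 : 0 < q by case/andP: q12 => h _; rewrite (lt_le_trans _ h)// invr_gt0.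
have u0 : 0 <= u.
  rewrite -lee_fin -wu; apply: nneseries_ge0 => j _ _.
  by rewrite lee_fin block_energy_ge0.
(* the bound is linear in the [2 * m]-th root of the energy *)
pose y := u `^ (2 * m)%:R^-1.
have y0 : 0 <= y by exact: powR_ge0.
have yu : y ^+ (2 * m) = u.
  rewrite -powR_mulrn// /y -powRrM mulVf ?powRr1//.
  by rewrite pnatr_eq0 -lt0n muln_gt0.
have wy : energy Z q m w = (y ^+ (2 * m))%:E by rewrite yu.
have hg := energy_block_grid m0 q12 y0 wy.
have hc := energy_coef_growth m0 q12 y0 wy.
split.
  exact: (class_in_E_L2_series y0 q12 hg hc).
have /andP[n0 n1] := class_E_norm_L2_series y0 q12 hg hc.
rewrite -/(fou beta t w) in n0 n1.
have tE : tail_bound y q 0 = sup_const q * y.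
  by rewrite /tail_bound /sup_const expr0 mulr1; ring.
set n := class_E_norm _ in n0 n1 *.
have : n ^+ (2 * m) <= sup_const q ^+ (2 * m) * u.
  by rewrite -yu -exprMn -tE lerXn2r ?nnegrE// (le_trans n0).
move=> nm; have [n_1|n_1] := leP n 1.
  apply: (@le_trans _ _ 1); first by rewrite exprn_ile1.
  by rewrite lerDl (le_trans _ nm)// exprn_ge0.
apply: (@le_trans _ _ (n ^+ (2 * m))); first by rewrite ler_weXn2l ?ltW// leq_mul2l.
by rewrite (le_trans nm)// lerDr.
Qed.

End FractionalOrnsteinUhlenbeck.

Theorem proposition3p2 (R : realType) (d : measure_display)
    (T : measurableType d) (P : probability T R) (H : R)
    (hH : 4^-1 < H < 2^-1 \/ 2^-1 < H < 1)
    (beta : nat -> R -> {RV P >-> R})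
    (hbeta : forall k : nat, (1 <= k)%N ->
       fractional_brownian_motion H (beta k))
    (hindep : independent_processes [set k : nat | (1 <= k)%N] beta) :
  (forall t : R, 0 <= t -> {ae P, forall w : T, class_in_E (fou beta t w)}) /\
  (forall p : nat, (1 <= p)%N ->
     (ereal_sup
        [set 'E_P[fun w => (class_E_norm (fou beta t w) ^+ (2 * p))%R]
          | t in [set t : R | (0 <= t)%R]] < +oo)%E).
Proof.
have [H4 H1] : 4^-1 < H /\ H < 1 by case: hH => /andP[h1 h2]; split=> //; lra.
have H01 : 0 < H < 1 by rewrite H1 andbT; lra.
have [q q12 hq] := dyadic_rate H4.
have q01 : 0 <= q < 1 by case/andP: q12 => h ->; rewrite andbT; lra.
have small : 0 < (64^-1 : R) by rewrite invr_gt0.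
have exm p : (0 < p)%N -> exists m : nat,
    [/\ (p <= m)%N, (0 < m)%N & 32 * q ^+ (2 * m) <= 2^-1].
  move=> p0; have [m pm hm] := expn_small p q01 small.
  by exists m; split => //; [exact: leq_trans pm|lra].
have key m t : (0 < m)%N -> 32 * q ^+ (2 * m) <= 2^-1 -> 0 <= t ->
    measurable_fun [set: T] (energy (fun k w => fou_coef beta t w k) q m) /\
    (\int[P]_w energy (fun k w => fou_coef beta t w k) q m w <=
     (@energy_const R m * 2)%:E)%E.
  move=> m0 qm t0.
  have q0 : 0 <= q by case/andP: q01.
  have hb := fou_block_subgaussian H01 hbeta hindep t0 q0 hq.
  have hz := fou_coef_subgaussian_cst H01 hbeta t0.
  split; first exact: (measurable_energy m q12 hb hz).
  exact: (integral_energy_le m0 q12 qm hb hz).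
have energy_ge0 t m w : (0 <= energy (fun k w => fou_coef beta t w k) q m w)%E.
  by apply: nneseries_ge0 => j _ _; rewrite lee_fin block_energy_ge0.
split.
  move=> t t0; have [m [_ m0 qm]] := exm 1%N isT.
  have [mU EU] := key m t m0 qm t0.
  have iU : P.-integrable [set: T] (energy (fun k w => fou_coef beta t w k) q m).
    apply/integrableP; split => //.
    under eq_integral do rewrite gee0_abs ?energy_ge0//.
    exact: le_lt_trans EU (ltry _).
  apply: filterS (integrable_ae measurableT iU) => w /(_ I) /fineK/esym Uw.
  exact: (fou_energy_bound m0 m0 q12 Uw).1.
move=> p p0; have [m [pm m0 qm]] := exm p p0.
apply: (@le_lt_trans _ _
  (1 + (sup_const q ^+ (2 * m))%:E * (@energy_const R m * 2)%:E)%E); last first.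
  by rewrite -EFinM -EFinD ltry.
apply: ge_ereal_sup => _ [t /= t0 <-].
have [mU EU] := key m t m0 qm t0.
have C0 : 0 < sup_const q ^+ (2 * m).
  rewrite exprn_gt0// /sup_const divr_gt0 ?subr_gt0//.
    by rewrite mulr_gt0// /block_const ltr_wpDr// mulr_ge0// pi_ge0.
  by case/andP: q12.
have E1 : (\int[P]_w cst 1%E w = 1 :> \bar R)%E.
  by rewrite integral_cst//= probability_setT mule1.
rewrite unlock.
apply: (@le_trans _ _ (\int[P]_w (cst 1%E w + (sup_const q ^+ (2 * m))%:E *
    energy (fun k w => fou_coef beta t w k) q m w))%E).
  apply: ge0_le_integral_nonmeasurable => w.
    by rewrite lee_fin exprM exprn_ge0 ?sqr_ge0.
  have := energy_ge0 t m w.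
  case Uw : (energy _ q m w) => [u| |] // _.
    rewrite -EFinM -EFinD lee_fin.
    exact: (fou_energy_bound m0 pm q12 Uw).2.
  by rewrite gt0_muley ?lte_fin// addey// leey.
rewrite ge0_integralD//; last 2 first.
- by move=> w _; rewrite mule_ge0// lee_fin ltW.
- exact: emeasurable_funM.
rewrite E1 leeD2l// ge0_integralZl//; last by rewrite lee_fin ltW.
by rewrite lee_wpmul2l// lee_fin ltW.
Qed.
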